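(* There is no quartic number field $K$ such that the number of elliptic curves $E$ over $K$ with $\mathbb{Z}/11\mathbb{Z}$ isomorphic to a subgroup of $E(K)$ is positive and finite.
   Context: Elliptic curves are counted up to isomorphism over $\overline{K}$. *)

(* Defs.v *)
From HB Require Import structures.
From mathcomp Require Import all_boot all_order all_algebra all_field.
From mathcomp Require Import ring.

Set Implicit Arguments.
Unset Strict Implicit.
Unset Printing Implicit Defensive.

Import GRing.Theory.
Local Open Scope ring_scope.

(* Weierstrass equation y^2 + a1 x y + a3 y = x^3 + a2 x^2 + a4 x + a6. *)
Record weierstrass (F : Type) := Weierstrass {
  wa1 : F; wa2 : F; wa3 : F; wa4 : F; wa6 : F }.

Definition wmap (F G : Type) (f : F -> G) (W : weierstrass F) : weierstrass G :=
  Weierstrass (f (wa1 W)) (f (wa2 W)) (f (wa3 W)) (f (wa4 W)) (f (wa6 W)).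

Section Weierstrass.
Variable F : fieldType.
Implicit Type W : weierstrass F.

Definition wdisc W : F :=
  let: Weierstrass a1 a2 a3 a4 a6 := W in
  let b2 := a1 ^+ 2 + 4%:R * a2 in
  let b4 := 2%:R * a4 + a1 * a3 in
  let b6 := a3 ^+ 2 + 4%:R * a6 in
  let b8 := a1 ^+ 2 * a6 + 4%:R * a2 * a6 - a1 * a3 * a4
            + a2 * a3 ^+ 2 - a4 ^+ 2 in
  - b2 ^+ 2 * b8 - 8%:R * b4 ^+ 3 - 27%:R * b6 ^+ 2 + 9%:R * b2 * b4 * b6.

(* W' is obtained from W by the admissible change of variables
   x = u^2 x' + r,  y = u^3 y' + u^2 s x' + t. *)
Definition wisom W W' : Prop :=
  let: Weierstrass a1 a2 a3 a4 a6 := W in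
  let: Weierstrass a1' a2' a3' a4' a6' := W' in
  exists u r s t : F,
  [/\ u != 0,
      u * a1' = a1 + 2%:R * s,
      u ^+ 2 * a2' = a2 - s * a1 + 3%:R * r - s ^+ 2,
      u ^+ 3 * a3' = a3 + r * a1 + 2%:R * t &
      u ^+ 4 * a4' = a4 - s * a3 + 2%:R * r * a2 - (t + r * s) * a1
                     + 3%:R * r ^+ 2 - 2%:R * s * t
   /\ u ^+ 6 * a6' = a6 + r * a4 + r ^+ 2 * a2 + r ^+ 3 - t * a3
                     - t ^+ 2 - r * t * a1].

Record ellcurve := EllCurve {
  ecw :> weierstrass F;
  ec_nonsingular : wdisc ecw != 0 }.

(* [None] is the point at infinity. *)
Definition oncurve W (p : option (F * F)) : bool :=
  if p is Some (x, y) then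
    y ^+ 2 + wa1 W * x * y + wa3 W * y
    == x ^+ 3 + wa2 W * x ^+ 2 + wa4 W * x + wa6 W
  else true.

(* Chord-and-tangent law: l and n are the slope and intercept of the line
   through the two points (the tangent when they coincide). *)
Definition padd W (p q : option (F * F)) : option (F * F) :=
  let: Weierstrass a1 a2 a3 a4 a6 := W in
  match p, q with
  | None, _ => q
  | _, None => p
  | Some (x1, y1), Some (x2, y2) =>
    if (x1 == x2) && (y1 + y2 + a1 * x2 + a3 == 0) then None
    else
      let l := if x1 == x2 then
                 (3%:R * x1 ^+ 2 + 2%:R * a2 * x1 + a4 - a1 * y1)
                 / (2%:R * y1 + a1 * x1 + a3)
               else (y2 - y1) / (x2 - x1) in
      let n := y1 - l * x1 in
      let x3 := l ^+ 2 + a1 * l - a2 - x1 - x2 in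
      Some (x3, - (l + a1) * x3 - n - a3)
  end.

Lemma padd_oncurve W p q :
  oncurve W p -> oncurve W q -> oncurve W (padd W p q).
Proof.
case: W => a1 a2 a3 a4 a6.
case: p q => [[x1 y1]|] [[x2 y2]|] //=.
move=> /eqP C1 /eqP C2.
case: (eqVneq x1 x2) => [E|nx] /=.
  subst x2.
  case: ifP => //= /negbT Hy.
  have Eyy : y2 = y1.
    have : (y1 - y2) * (y1 + y2 + a1 * x1 + a3) = 0.
      transitivity ((y1 ^+ 2 + a1 * x1 * y1 + a3 * y1)
                    - (y2 ^+ 2 + a1 * x1 * y2 + a3 * y2)); first by ring.
      by rewrite C1 C2 subrr.
    by move/eqP; rewrite mulf_eq0 (negPf Hy) orbF subr_eq0 => /eqP.
  subst y2.
  have {}Hy : 2%:R * y1 + a1 * x1 + a3 != 0.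
    by rewrite mulr_natl mulr2n.
  set l := _ / _.
  have El : l * (2%:R * y1 + a1 * x1 + a3)
            = 3%:R * x1 ^+ 2 + 2%:R * a2 * x1 + a4 - a1 * y1 by rewrite divfK.
  move: l El => l El.
  have E4 : a4 = l * (2%:R * y1 + a1 * x1 + a3) - 3%:R * x1 ^+ 2
                 - 2%:R * a2 * x1 + a1 * y1 by rewrite El; ring.
  have E6 : a6 = y1 ^+ 2 + a1 * x1 * y1 + a3 * y1
                 - (x1 ^+ 3 + a2 * x1 ^+ 2 + a4 * x1) by rewrite C1; ring.
  by apply/eqP; rewrite E6 E4; ring.
set l := _ / _.
have d0 : x2 - x1 != 0 by rewrite subr_eq0 eq_sym.
have El : y2 = y1 + l * (x2 - x1) by rewrite divfK // addrC subrK.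
move: l El => l El; subst y2.
have E6 : a6 = y1 ^+ 2 + a1 * x1 * y1 + a3 * y1
               - (x1 ^+ 3 + a2 * x1 ^+ 2 + a4 * x1) by rewrite C1; ring.
have E4 : a4 = l * (2%:R * y1 + l * (x2 - x1)) + a1 * (y1 + l * x2) + a3 * l
               - (x1 ^+ 2 + x1 * x2 + x2 ^+ 2) - a2 * (x1 + x2).
  apply: (mulfI d0); move: C2; rewrite E6 => /eqP; rewrite -subr_eq0 => /eqP H.
  by apply/eqP; rewrite -subr_eq0; apply/eqP; rewrite -[RHS]oppr0 -H; ring.
by apply/eqP; rewrite E6 E4; ring.
Qed.

Definition ecpoint (E : ellcurve) := {p : option (F * F) | oncurve E p}.

Definition ecadd (E : ellcurve) (P Q : ecpoint E) : ecpoint E :=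
  exist _ (padd E (val P) (val Q)) (padd_oncurve (valP P) (valP Q)).

(* E(F) has a subgroup isomorphic to A, namely the image of f. *)
Definition has_subgroup_isog (A : zmodType) (E : ellcurve) : Prop :=
  exists2 f : A -> ecpoint E,
    injective f & {morph f : a b / a + b >-> ecadd a b}.

End Weierstrass.

(* L, with the embedding iota, is an algebraic closure of F. *)
Definition algebraic_closure (F : fieldType) (L : closedFieldType)
    (iota : {rmorphism F -> L}) : Prop :=
  forall z : L, algebraicOver iota z.

Definition isom_over (F L : fieldType) (iota : {rmorphism F -> L})
    (E E' : ellcurve F) : Prop :=
  wisom (wmap iota E) (wmap iota E').

(* The objects satisfying P, counted up to the relation R, are exactly n in
   number: e is a complete irredundant system of representatives. *)
Definition number_up_to (T : Type) (R : T -> T -> Prop) (P : T -> Prop)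
    (n : nat) : Prop :=
  exists e : 'I_n -> T,
    [/\ forall i, P (e i),
        forall i j, R (e i) (e j) -> i = j
      & forall x, P x -> exists i, R x (e i)].

(* Main.v *)
(* Points of C : y^2 + y = x^3 - x^2, a model of X_1(11), with x <> 0, 1
   parametrize elliptic curves with a point of order 11; the affine points with
   x = 0, 1 are the rational cusps.  A curve with Z/11 over the quartic field K
   thus gives a noncuspidal point P of C(K), and it suffices to show that the
   points 2^n P have distinct x, since only finitely many x give curves
   isomorphic over Kbar to a fixed one.

   On x, duplication is f(x) = (x^4 - 2 x + 1) / (4 x^3 - 4 x^2 + 1).  Choose a
   valuation ring V of K above 2.  Modulo the maximal ideal f(x) = x^4 + 1, so f
   contracts residue discs; residues have degree at most 4 over F_2, and for
   coordinates of points of C(K) this forces f(f(x)) = x modulo the maximal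
   ideal.  A periodic integral x therefore satisfies f(f(x)) = x exactly, and a
   nonintegral x has an infinite orbit.  The equation f(f(x)) = x means 3 P = 0,
   which has no solution on C over F_16 or its subfields, or 5 P = 0, where x is 0 or
   1 or generates an extension with ramification index divisible by 5 at 11,
   which is impossible in degree 4.  Hence no argument uses associativity of the
   group law. *)
Require Import Defs.
From HB Require Import structures.
From mathcomp Require Import all_boot all_order all_algebra all_field.
From mathcomp Require Import zify ring.
From mathcomp Require Import boolp classical_sets.

Set Implicit Arguments.
Unset Strict Implicit.
Unset Printing Implicit Defensive.

Import GRing.Theory.
Local Open Scope ring_scope.

(** * Valuation rings of a field *)

Section ValuationRings.
Variables (K : fieldType) (p : nat).

Definition subring (S : K -> Prop) : Prop :=
  [/\ S 1, forall a b, S a -> S b -> S (a - b) & forall a b, S a -> S b -> S (a * b)].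

(** [V] is a predicate on [K], so that Zorn's lemma can be applied to subsets of [K]. [vr_res] puts
    p in the maximal ideal, hence for prime p the residue characteristic is p. *)
Record valring (V : K -> Prop) : Prop := ValRing {
  vr_subring : subring V;
  vr_total : forall u, V u \/ V u^-1;
  vr_res : ~ V p%:R^-1 }.

Section Subrings.
Variable S : K -> Prop.
Hypothesis subS : subring S.

Lemma subring1 : S 1. Proof. by case: subS. Qed.
Lemma subringB a b : S a -> S b -> S (a - b). Proof. by case: subS => ? + ?; exact. Qed.
Lemma subringM a b : S a -> S b -> S (a * b). Proof. by case: subS => ? ?; exact. Qed.
Lemma subring0 : S 0. Proof. by rewrite -(subrr 1); apply: subringB; exact: subring1. Qed.
Lemma subringN a : S a -> S (- a).
Proof. by rewrite -sub0r; apply: subringB; exact: subring0. Qed.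
Lemma subringD a b : S a -> S b -> S (a + b).
Proof. by move=> Sa Sb; rewrite -[b]opprK; apply/subringB/subringN. Qed.
Lemma subringX a n : S a -> S (a ^+ n).
Proof. by move=> Sa; elim: n => [|n IH]; rewrite ?expr0 ?exprS; [exact:
    subring1|exact: subringM]. Qed.
Lemma subring_nat n : S n%:R.
Proof. by elim: n => [|n IH]; [exact: subring0|rewrite -natr1; apply: subringD => //;
    exact: subring1]. Qed.
Lemma subring_int (n : int) : S n%:~R.
Proof. by case: n => n; rewrite ?NegzE ?mulrNz; [|apply: subringN]; exact:
    subring_nat. Qed.
Lemma subring_sum I (r : seq I) (F : I -> K) :
  (forall i, S (F i)) -> S (\sum_(i <- r) F i).
Proof.
move=> SF; elim: r => [|i r IH]; rewrite ?big_nil ?big_cons; first exact: subring0.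
exact: subringD.
Qed.

Definition adjoin (u : K) : K -> Prop :=
  fun v => exists2 a : {poly K}, forall i, S a`_i & v = a.[u].

Lemma adjoin_subring u : subring (adjoin u).
Proof.
split=> [|_ _ [a Sa ->] [b Sb ->]|_ _ [a Sa ->] [b Sb ->]].
- exists 1; last by rewrite hornerC.
  by move=> i; rewrite coef1; exact: subring_nat.
- exists (a - b); last by rewrite hornerD hornerN.
  by move=> i; rewrite coefB; exact: subringB.
exists (a * b); last by rewrite hornerM.
by move=> i; rewrite coefM; apply: subring_sum => j; exact: subringM.
Qed.

Lemma sub_adjoin u v : S v -> adjoin u v.
Proof.
move=> Sv; exists v%:P; last by rewrite hornerC.
by move=> i; rewrite coefC; case: ifP => // _; exact: subring0.
Qed.

Lemma adjoin_self u : adjoin u u.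
Proof. by exists 'X; [move=> i; rewrite coefX; exact: subring_nat|rewrite hornerX]. Qed.

End Subrings.

Section Maximal.
Variable S : K -> Prop.
Hypothesis subS : subring S.
Hypothesis p0 : p%:R != 0 :> K.
Hypothesis Sp : ~ S p%:R^-1.
Hypothesis maxS : forall T : K -> Prop, subring T -> (forall a, S a -> T a) ->
  ~ T p%:R^-1 -> forall a, T a -> S a.

(** By maximality, adjoining u brings in 1/p; the relation is p times an expression of 1/p as a
    polynomial in u. *)
Lemma adjoin_out u : ~ S u ->
  exists2 a : {poly K}, forall i, S a`_i & 1 = p%:R * a.[u].
Proof.
move=> Su; case: (pselect (adjoin S u p%:R^-1)) => [[a Sa Ea]|nT].
  by exists a => //; rewrite -Ea mulfV.
case: Su; apply: (maxS (adjoin_subring subS u) _ nT); last exact: adjoin_self.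
exact: sub_adjoin.
Qed.

(** If d = 1 - p b had its inverse w outside [S], there would be a relation 1 = p a(w). Multiplying
    by a power of d clears w, and that power is 1 modulo p [S], so 1/p would lie in [S]. *)
Lemma maximal_unit b : S b -> S (1 - p%:R * b)^-1.
Proof.
move=> Sb; set w := _^-1; case: (pselect (S w)) => // nSw.
have [a Sa Ea] := adjoin_out nSw.
set d := 1 - p%:R * b in w nSw Ea *.
have Sd : S d.
  by apply: subringB => //; [exact: subring1|apply: subringM => //; exact: subring_nat].
have d0 : d != 0.
  apply: contra_notN nSw => /eqP; rewrite /w => ->.
  by rewrite invr0; exact: subring0.
have [e Se Ee] : exists2 e, S e & d ^+ size a = 1 - p%:R * e.
  elim: (size a) => [|n [e Se Ee]].
    by exists 0; [exact: subring0|rewrite mulr0 subr0].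
  exists (b + e - p%:R * b * e); last by rewrite exprS Ee /d; ring.
  have Sp' := subring_nat subS p.
  by apply: subringB => //; [exact: subringD|apply: subringM => //; exact: subringM].
have Saw : S (d ^+ size a * a.[w]).
  rewrite horner_coef mulr_sumr; apply: subring_sum => // i.
  rewrite mulrCA; apply: subringM => //.
  have -> : d ^+ size a = d ^+ (size a - i) * d ^+ i by rewrite -exprD subnK // ltnW.
  by rewrite /w exprVn mulfK ?expf_neq0 //; exact: subringX.
case: Sp; have -> : p%:R^-1 = e + d ^+ size a * a.[w].
  by apply: (mulfI p0); rewrite mulfV // mulrDr mulrCA -Ea mulr1 Ee addrC subrK.
exact: subringD.
Qed.

(* Chevalley: two relations [1 = p a(u)] and [1 = p b(1/u)] of minimal degrees
   would let the longer one be shortened by the other. *)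
Lemma maximal_total u : S u \/ S u^-1.
Proof.
suff H n m : forall (u : K) (a b : {poly K}), u != 0 -> (size a <= n)%N -> (size b <=
    m)%N ->
    (forall i, S a`_i) -> (forall i, S b`_i) ->
    1 = p%:R * a.[u] -> 1 = p%:R * b.[u^-1] -> False.
  case: (eqVneq u 0) => [->|u0]; first by left; exact: subring0.
  case: (pselect (S u)) => [|nu]; first by left.
  case: (pselect (S u^-1)) => [|nv]; first by right.
  have [a Sa Ea] := adjoin_out nu; have [b Sb Eb] := adjoin_out nv.
  by case: (H _ _ u a b u0 (leqnn _) (leqnn _) Sa Sb Ea Eb).
have [k] := ubnP (n + m); elim: k n m => // k IH n m; rewrite ltnS => lek.
wlog lemn : n m lek / (m <= n)%N.
  move=> Hw {}u a b u0 sa sb Sa Sb Ea Eb; case: (leqP m n) => [le|/ltnW le].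
    exact: (Hw n m lek le u a b).
  apply: (Hw m n _ le u^-1 b a) => //; rewrite ?invrK ?invr_eq0 //.
  by rewrite addnC.
move=> {}u a b u0 sa sb Sa Sb Ea Eb.
have short c : S c -> 1 <> p%:R * c.
  by move=> Sc E; case: Sp; suff -> : p%:R^-1 = c by []; apply: (mulfI p0); rewrite mulfV.
case: m sb lek lemn => [|m] sb lek lemn.
  move: sb Eb; rewrite leqn0 size_poly_eq0 => /eqP ->; rewrite horner0.
  exact: (short _ (subring0 subS)).
case: n sa lek lemn => [//|n] sa lek lemn.
rewrite ltnS in lemn.
(* Dividing by the unit 1 - p b_0 removes the constant term of the relation in 1/u. *)
set w := (1 - p%:R * b`_0)^-1.
have Sw : S w by exact: maximal_unit.
have w0 : 1 - p%:R * b`_0 != 0.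
  by apply/negP => /eqP/subr0_eq; exact: short.
have Eb' : 1 = p%:R * \sum_(j < m) w * b`_j.+1 * u^-1 ^+ j.+1.
  have E : 1 - p%:R * b`_0 = p%:R * \sum_(j < m) b`_j.+1 * u^-1 ^+ j.+1.
    apply/eqP; rewrite subr_eq addrC -mulrDr; apply/eqP/(etrans Eb); congr (_ * _).
    by rewrite (horner_coef_wide _ sb) big_ord_recl expr0 mulr1.
  apply: etrans (esym (mulVf w0)) _; rewrite -/w [X in w * X]E mulrCA mulr_sumr;
      congr (_ * _).
  by apply: eq_bigr => j _; rewrite mulrA.
(* The top term a_n u^n is multiplied by [Eb'], whose exponents of u are all negative, and so
   spreads over degrees below n; m <= n keeps these degrees nonnegative. *)
pose a' := \poly_(i < n) (a`_i +
   (if (n - i.+1 < m)%N then p%:R * a`_n * w * b`_(n - i) else 0)).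
apply: (IH n m.+1 _ u a' b) => //.
- exact: size_poly.
- move=> i; rewrite coef_poly; case: ifP => _; last exact: subring0.
  apply: subringD => //; case: ifP => _; last exact: subring0.
  by do 3!apply: subringM => //; exact: subring_nat.
apply: (etrans Ea); congr (_ * _).
rewrite (horner_coef_wide _ sa) big_ord_recr /=.
rewrite (horner_coef_wide _ (size_poly _ _)).
have -> : a`_n * u ^+ n = \sum_(i < n)
   (if (n - i.+1 < m)%N then p%:R * a`_n * w * b`_(n - i) else 0) * u ^+ i.
  rewrite -[LHS]mulr1 [X in _ * X]Eb' [RHS](reindex_inj rev_ord_inj) /=.
  rewrite mulrCA mulr_sumr mulr_sumr.
  rewrite (big_ord_widen n (fun j => p%:R * (a`_n * u ^+ n * (w * b`_j.+1 * u^-1 ^+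
      j.+1)))) //.
  rewrite big_mkcond; apply: eq_bigr => i _ /=.
  have le_in : (i.+1 <= n)%N by [].
  have E1 : (n - (n - i.+1).+1)%N = i by lia.
  have E2 : (n - (n - i.+1))%N = i.+1 by lia.
  rewrite E1 E2; case: ifP => _; last by rewrite mul0r.
  have -> : u ^+ n = u ^+ (n - i.+1) * u ^+ i.+1 by rewrite -exprD subnK.
  rewrite exprVn; field.
  by rewrite expf_neq0.
rewrite -big_split; apply: eq_bigr => i _ /=.
by rewrite coef_poly ltn_ord mulrDl.
Qed.

End Maximal.

Lemma valring_exists : (1 < p)%N -> p%:R != 0 :> K ->
  (forall n : int, p%:R^-1 != n%:~R :> K) -> exists V, valring V.
Proof.
move=> p1 p0 pZ.
pose P (S : set K) := S = set0 \/ (subring S /\ ~ S p%:R^-1).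
have [F FP Ftot|S [PS maxS]] := @Zorn_bigcup K P.
  have [->|/set0P[x [S0 FS0 S0x]]] := eqVneq ((\bigcup_(X in F) X)%classic : set K)
      set0; first by left.
  right.
  have sub1 T y : F T -> T y -> subring T /\ ~ T p%:R^-1.
    by move=> /FP[->//|].
  have two a b : (\bigcup_(X in F) X)%classic a -> (\bigcup_(X in F) X)%classic b ->
    exists T, [/\ F T, subring T, T a & T b].
    move=> [T FT Ta] [U FU Ub]; case: (Ftot T U FT FU) => TU.
      by exists U; split=> //; [case: (sub1 _ _ FU Ub)|exact: TU].
    by exists T; split=> //; [case: (sub1 _ _ FT Ta)|exact: TU].
  split; last by move=> [T FT Tp]; case: (sub1 _ _ FT Tp).
  split.
  - by exists S0 => //; case: (sub1 _ _ FS0 S0x) => /subring1.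
  - by move=> a b /two H /H [T [FT sT Ta Tb]]; exists T => //; exact: subringB.
  - by move=> a b /two H /H [T [FT sT Ta Tb]]; exists T => //; exact: subringM.
have PZ : subring [set x : K | exists n : int, x = n%:~R]%classic.
  split; first by exists 1.
  - by move=> _ _ [m ->] [n ->]; exists (m - n); rewrite rmorphB.
  - by move=> _ _ [m ->] [n ->]; exists (m * n); rewrite rmorphM.
case: PS => [S0|[sS Sp]].
  exfalso; apply: (maxS _ _ (or_intror (conj PZ _))).
    by rewrite S0; split=> // /(_ 1); apply; exists 1.
  by case=> n /eqP; rewrite (negPf (pZ n)).
exists S; split=> // u; apply: maximal_total => // T sT ST Tp.
apply: contrapT => nTS; apply: (maxS T); last by right.
by split.
Qed.

End ValuationRings.

(** The maximal ideal of [V]. Zero is listed apart because 0^-1 = 0 lies in [V]. *)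
Definition nonunit (K : fieldType) (V : K -> Prop) (u : K) : Prop := u = 0 \/ ~ V u^-1.

Section MaximalIdeal.
Variables (K : fieldType) (p : nat) (V : K -> Prop).
Hypothesis vV : valring p V.
Let sV : subring V := vr_subring vV.
Local Notation M := (nonunit V).

Lemma nonunit_in u : M u -> V u.
Proof.
case=> [->|nu]; first exact: (subring0 sV).
by case: (vr_total vV u).
Qed.

Lemma notin_nonunit u : ~ V u -> M u^-1.
Proof. by move=> nu; right; rewrite invrK. Qed.

Lemma nonunit0 : M 0. Proof. by left. Qed.

Lemma nonunitMl a b : M a -> V b -> M (a * b).
Proof.
have [-> _ _|a0] := eqVneq a 0; first by rewrite mul0r; left.
have [-> _ _|b0] := eqVneq b 0; first by rewrite mulr0; left.
case=> [/eqP|na Vb]; first by rewrite (negPf a0).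
right=> Vab; apply: na; have -> : a^-1 = (a * b)^-1 * b by field; apply/andP.
exact: (subringM sV).
Qed.

Lemma nonunitMr a b : V a -> M b -> M (a * b).
Proof. by move=> Va Mb; rewrite mulrC; exact: nonunitMl. Qed.

Lemma nonunitN a : M a -> M (- a).
Proof.
move=> Ma; rewrite -mulrN1; apply: nonunitMl => //.
by apply: (subringN sV); exact: (subring1 sV).
Qed.

Lemma nonunit1 : ~ M 1.
Proof.
by case=> [/eqP|]; [rewrite oner_eq0|rewrite invr1; case; exact: (subring1 sV)].
Qed.

Lemma unit_nonunit a : V a -> ~ M a -> V a^-1.
Proof. by move=> Va nMa; apply: contrapT => nV; apply: nMa; right. Qed.

(** One of a/b and b/a lies in [V]; the term of smaller valuation is factored out of the sum. *)
Lemma nonunitD a b : M a -> M b -> M (a + b).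
Proof.
wlog Vab : a b / V (a / b).
  move=> H Ma Mb; case: (vr_total vV (a / b)) => [|]; first by move/H; exact.
  by rewrite invf_div addrC => /H; exact.
move=> Ma Mb; have [b0|b0] := eqVneq b 0; first by rewrite b0 addr0.
have -> : a + b = b * (1 + a / b) by field.
by apply: nonunitMl => //; apply: (subringD sV) => //; exact: (subring1 sV).
Qed.

Lemma nonunitB a b : M a -> M b -> M (a - b).
Proof. by move=> Ma Mb; apply/nonunitD/nonunitN. Qed.

Lemma nonunit_p : M p%:R.
Proof. by right; exact: vr_res. Qed.

Lemma nonunit_prime a b : V a -> V b -> M (a * b) -> M a \/ M b.
Proof.
move=> Va Vb Mab; case: (pselect (M a)) => [|na]; [by left|right].
case: (pselect (M b)) => // nb; case: nonunit1.
have a0 : a != 0 by apply: contra_notN na => /eqP->; left.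
have b0 : b != 0 by apply: contra_notN nb => /eqP->; left.
have -> : 1 = a * b * (a^-1 * b^-1) by field; apply/andP.
by apply: nonunitMl => //; apply: (subringM sV); exact: unit_nonunit.
Qed.

Lemma nonunit_expr a n : M a -> (0 < n)%N -> M (a ^+ n).
Proof.
case: n => // n Ma _; rewrite exprS; apply: nonunitMl => //.
exact/(subringX sV)/nonunit_in.
Qed.

Lemma expr_nonunit a n : (0 < n)%N -> M (a ^+ n) -> M a.
Proof.
have [->|a0] := eqVneq a 0; first by left.
move=> n0 [/eqP|nV]; first by rewrite expf_eq0 n0 (negPf a0).
by right=> Va; apply: nV; rewrite -exprVn; exact: (subringX sV).
Qed.

(** Otherwise a Bezout relation between p and n would put 1 in the maximal ideal. *)
Lemma int_nonunit (n : int) : prime p -> M n%:~R -> (p %| n)%Z.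
Proof.
move=> pp Mn; apply/negPn/negP => npn.
have : coprimez p n by rewrite /coprimez /gcdz -prime_coprime // in npn *.
case/coprimezP => -[u v] /= E; apply: nonunit1.
rewrite -[1]/(1%:~R) -E rmorphD !rmorphM /=.
by apply: nonunitD; apply: nonunitMr;
  rewrite -?pmulrn //; [exact: (subring_int sV)|exact: nonunit_p|exact: (subring_int sV)].
Qed.

Lemma unit_add1 m : M m -> V (1 + m)^-1.
Proof.
move=> Mm; apply: unit_nonunit.
  by apply: (subringD sV); [exact: (subring1 sV)|exact: nonunit_in].
by move=> M1; apply: nonunit1; rewrite -(addrK m 1); exact: nonunitB.
Qed.

End MaximalIdeal.

Ltac in_valring sV :=
  repeat first [assumption | exact: (subring1 sV) | exact: (subring0 sV)
    | exact: (subring_nat sV) | exact: (subring_int sV) | apply: (subringX sV)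
    | apply: (subringD sV) | apply: (subringN sV) | apply: (subringM sV)].

(** * Residues of degree at most 4 above 2 *)

Section Dyadic.
Variables (K : fieldType) (V : K -> Prop).
Hypothesis vV : valring 2 V.
Let sV : subring V := vr_subring vV.
Local Notation M := (nonunit V).

(** The certificate used for congruences modulo 2: with the cofactor g and the explicit multiple of
    2 supplied, only a polynomial identity remains for [ring]. *)
Lemma nonunit_mod2 e f g h : M f -> V g -> V h -> e = f * g + 2%:R * h -> M e.
Proof.
move=> Mf Vg Vh ->; apply: (nonunitD vV); apply: (nonunitMl vV) => //.
exact: nonunit_p.
Qed.

(* Every irreducible polynomial of degree at most 4 over F_2 divides
   [X^16 - X] or [X^8 - X]. *)
Lemma residue_degree4 a (e : nat -> bool) : V a ->
  M (\sum_(i < 5) (e i)%:R * a ^+ i) -> (exists i : 'I_5, e i) ->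
  M (a ^+ 16 - a) \/ M (a ^+ 8 - a).
Proof.
move=> Va.
pose G := M (a ^+ 16 - a) \/ M (a ^+ 8 - a).
have Ga : M a -> G.
  move=> Ma; right; have -> : a ^+ 8 - a = a * (a ^+ 7 - 1) by ring.
  by apply: (nonunitMl vV) => //; in_valring sV.
have G1 : M (1 + a) -> G.
  pose g := a * (1 + a + a ^+ 2 + a ^+ 3 + a ^+ 4 + a ^+ 5 + a ^+ 6).
  have Vg : V g by in_valring sV.
  move=> Ma; right; apply: (nonunit_mod2 (h := - g) Ma Vg); first exact: (subringN sV).
  by rewrite /g; ring.
have P1 f : V f -> M ((1 + a) * f) -> G \/ M f.
  move=> Vf /(nonunit_prime vV) [||/G1|]; auto; in_valring sV.
have P0 f : V f -> M (a * f) -> G \/ M f.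
  by move=> Vf /(nonunit_prime vV) [||/Ga|]; auto.
have n1 : M 1 -> G by move/(nonunit1 vV).
(* [L1] to [L4] treat polynomials with constant term 1 and degree at most 1 to 4. An even number of
   nonzero coefficients means that 1 is a root, and 1 + X is divided out; what then remains in full
   degree is irreducible or is (1 + X + X^2)^2. *)
have L1 (e1 : bool) : M (1 + e1%:R * a) -> G.
  by case: e1; rewrite /= ?mulr1n ?mulr0n ?mul1r ?mul0r ?addr0; [exact: G1|exact: n1].
have L2 (e1 e2 : bool) : M (1 + e1%:R * a + e2%:R * a ^+ 2) -> G.
  case E : (e1 (+) e2) => H.
    have : M ((1 + a) * (1 + (~~ e1)%:R * a)).
      apply: (nonunit_mod2 (g := 1) (h := (~~ e1)%:R * a) H); [by in_valring sV..|].
      by case: e1 e2 E {H} => [] [] // _; rewrite /=; ring.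
    by case/P1 => //; [in_valring sV|exact: L1].
  case: e1 e2 E H => [] [] // _; rewrite /= ?mulr1n ?mulr0n ?mul0r ?mul1r ?addr0 //
      => H; left.
  apply: (nonunit_mod2 (g := (a ^+ 2 - a) * (1 + a ^+ 3 + a ^+ 6 + a ^+ 9 + a ^+ 12))
      (h := 0) H);
    [by in_valring sV..|by ring].
have L3 (e1 e2 e3 : bool) : M (1 + e1%:R * a + e2%:R * a ^+ 2 + e3%:R * a ^+ 3) -> G.
  case E : (e1 (+) e2 (+) e3) => H.
    (* Coefficients of the quotient by 1 + X, from the constant term up; the cofactor of 2 below
       records the carries. *)
    pose f1 := ~~ e1; pose f2 := f1 (+) e2.
    have : M ((1 + a) * (1 + f1%:R * a + f2%:R * a ^+ 2)).
      apply: (nonunit_mod2 (g := 1) (h := f1%:R * a + (f1 && f2)%:R * a ^+ 2) H); [by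
          in_valring sV..|].
      by move: E; rewrite /f2 /f1; clear; case: e1 e2 e3 => [] [] [] // _; rewrite
          /=; ring.
    by case/P1 => //; [in_valring sV|exact: L2].
  case: e3 E H => [|_ H]; last by apply: (L2 e1 e2); move: H; rewrite mulr0n mul0r addr0.
  case: e1 e2 => [] [] // _; rewrite /= ?mulr1n ?mulr0n ?mul0r ?mul1r ?addr0 // => H;
      right.
    apply: (nonunit_mod2 (g := a + a ^+ 2 + a ^+ 3 + a ^+ 5)
     (h := - a - a ^+ 2 - a ^+ 3 - a ^+ 4 - a ^+ 5 - a ^+ 6) H);
    [by in_valring sV..|by ring].
  apply: (nonunit_mod2 (g := a + a ^+ 3 + a ^+ 4 + a ^+ 5)
     (h := - a - a ^+ 3 - a ^+ 4 - a ^+ 5 - a ^+ 6 - a ^+ 7) H);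
    [by in_valring sV..|by ring].
have L4 (e1 e2 e3 e4 : bool) : M (1 + e1%:R * a + e2%:R * a ^+ 2 + e3%:R * a ^+ 3 +
    e4%:R * a ^+ 4) -> G.
  case E : (e1 (+) e2 (+) e3 (+) e4) => H.
    pose f1 := ~~ e1; pose f2 := f1 (+) e2; pose f3 := f2 (+) e3.
    have : M ((1 + a) * (1 + f1%:R * a + f2%:R * a ^+ 2 + f3%:R * a ^+ 3)).
      apply: (nonunit_mod2 (g := 1) (h := f1%:R * a + (f1 && f2)%:R * a ^+ 2 + (f2 &&
          f3)%:R * a ^+ 3) H); [by in_valring sV..|].
      by move: E; rewrite /f3 /f2 /f1; clear; case: e1 e2 e3 e4 => [] [] [] [] // _;
          rewrite /=; ring.
    by case/P1 => //; [in_valring sV|exact: L3].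
  case: e4 E H => [|_ H]; last by apply: (L3 e1 e2 e3); move: H; rewrite mulr0n mul0r
      addr0.
  case: e1 e2 e3 => [] [] [] // _; rewrite /= ?mulr1n ?mulr0n ?mul0r ?mul1r ?addr0 //
      => H.
  - left; apply: (nonunit_mod2 (g := (a ^+ 2 - a) * (1 + a ^+ 5 + a ^+ 10)) (h := 0) H);
    [by in_valring sV..|by ring].
  - left; apply: (nonunit_mod2 (g := a + a ^+ 2 + a ^+ 3 + a ^+ 4 + a ^+ 6 + a ^+ 8 +
      a ^+ 9 + a ^+ 12)
     (h := - a - a ^+ 2 - a ^+ 3 - a ^+ 4 - a ^+ 5 - a ^+ 6 - a ^+ 7 - a ^+ 8 - a ^+
         9 - a ^+ 10 - a ^+ 12 - a ^+ 13) H);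
    [by in_valring sV..|by ring].
  - apply: (L2 true true); apply: (expr_nonunit vV (n := 2)) => //.
    by apply: (nonunit_mod2 (g := 1) (h := a + a ^+ 2 + a ^+ 3) H); [in_valring
        sV..|rewrite /=; ring].
  - left; apply: (nonunit_mod2 (g := a + a ^+ 4 + a ^+ 5 + a ^+ 7 + a ^+ 9 + a ^+ 10
      + a ^+ 11 + a ^+ 12)
     (h := - a - a ^+ 4 - a ^+ 5 - a ^+ 7 - a ^+ 8 - a ^+ 9 - a ^+ 10 - a ^+ 11 - a
         ^+ 12 - a ^+ 13 - a ^+ 14 - a ^+ 15) H);
    [by in_valring sV..|by ring].
rewrite !big_ord_recr big_ord0 /= add0r expr0 mulr1 expr1.
(* The power of [a] before the first nonzero coefficient is split off. *)
case E0 : (e 0%N); first by move=> H _; exact: L4 H.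
rewrite mulr0n add0r.
case E1 : (e 1%N).
  move=> H _.
  have /P0[|//|] : M (a * (1 + (e 2)%:R * a + (e 3)%:R * a ^+ 2 + (e 4)%:R * a ^+ 3)).
  - by apply: (eq_ind _ M H); rewrite /=; ring.
  - by in_valring sV.
  - exact: L3.
rewrite mulr0n mul0r add0r.
case E2 : (e 2%N).
  move=> H _.
  have /P0[|//|] : M (a * (a * (1 + (e 3)%:R * a + (e 4)%:R * a ^+ 2))).
  - by apply: (eq_ind _ M H); rewrite /=; ring.
  - by in_valring sV.
  - by move/P0 => [|//|]; [in_valring sV|exact: L2].
rewrite mulr0n mul0r add0r.
case E3 : (e 3%N).
  move=> H _.
  have /P0[|//|] : M (a * (a ^+ 2 * (1 + (e 4)%:R * a))).
  - by apply: (eq_ind _ M H); rewrite /=; ring.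
  - by in_valring sV.
  - case/(nonunit_prime vV); [by in_valring sV..| |exact: L1].
    by move/(expr_nonunit vV (n := 2) isT)/Ga.
rewrite mulr0n mul0r add0r.
case E4 : (e 4%N).
  move=> H _.
  by move: H; rewrite mulr1n mul1r => /(expr_nonunit vV (n := 4) isT)/Ga.
by move=> _ [[[|[|[|[|[|i]]]]] //= _]]; rewrite ?E0 ?E1 ?E2 ?E3 ?E4.
Qed.

End Dyadic.

(** * Number fields *)

Section NumberField.
Variable K : fieldExtType rat.

Lemma nf_natr_eq0 n : (n%:R == 0 :> K) = (n == 0)%N.
Proof. by rewrite -(rmorph_nat (in_alg K)) fmorph_eq0 Num.Theory.pnatr_eq0. Qed.

Lemma int_alg (n : int) : n%:~R%:A = n%:~R :> K.
Proof. by rewrite -in_algE rmorph_int. Qed.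

Lemma nf_intr_eq0 (n : int) : (n%:~R == 0 :> K) = (n == 0).
Proof. by rewrite -int_alg -in_algE fmorph_eq0 intr_eq0. Qed.

Lemma nf_valring_exists (p : nat) : prime p -> exists V : K -> Prop, valring p V.
Proof.
move=> pp; have p0 : p%:R != 0 :> K by rewrite nf_natr_eq0 -lt0n prime_gt0.
apply: valring_exists => // [|n]; first exact: prime_gt1.
apply/eqP => E; have /eqP : (p%:Z * n)%:~R = 1%:~R :> K by rewrite intrM -E -pmulrn mulfV.
rewrite -subr_eq0 -intrB nf_intr_eq0 subr_eq0 => /eqP pn.
have : (p %| 1)%Z by apply/dvdzP; exists n; rewrite mulrC pn.
by rewrite dvdzE dvdn1 /= => /eqP p1; move: pp; rewrite p1.
Qed.

Lemma rat_minimal_polynomial (x : K) : exists m : {poly rat},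
  [/\ size m = (size m).-1.+1, (0 < (size m).-1)%N, ((size m).-1 %| \dim {:K})%N,
      (map_poly (in_alg K) m).[x] = 0
    & forall g : {poly rat}, (map_poly (in_alg K) g).[x] = 0 -> m %| g].
Proof.
have /polyOver1P[m Em] := minPolyOver 1 x.
have sz : size m = (adjoin_degree 1 x).+1.
  by rewrite -(size_map_poly (in_alg K)) -Em size_minPoly.
exists m; rewrite sz; split=> //.
- have := field_dimS (subvf <<1; x>>%AS).
  by rewrite dim_Fadjoin dimv1 muln1.
- by rewrite -Em minPolyxx.
move=> g /rootP gx; rewrite -(dvdp_map (in_alg K)) -Em.
by apply: minPoly_dvdp => //; apply/polyOver1P; exists g.
Qed.

(** Denominators of the minimal polynomial are cleared and its primitive part taken: a prime
    dividing every coefficient would divide the content 1. *)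
Lemma int_relation (p : nat) (x : K) : prime p -> exists c : {poly int},
  [/\ (size c <= (\dim {:K}).+1)%N, exists i, ~~ (p %| c`_i)%Z
    & \sum_(i < size c) (c`_i)%:~R * x ^+ i = 0].
Proof.
move=> pp; have [m [sz m0 dm mx _]] := rat_minimal_polynomial x.
have [q [a a0 Eq]] := rat_poly_scale m.
have Esz : size q = size m.
  rewrite Eq size_scale ?invr_eq0 ?intr_eq0 //.
  by rewrite size_map_inj_poly //; exact: intr_inj.
have q0 : q != 0 by rewrite -size_poly_gt0 Esz sz.
exists (zprimitive q); rewrite size_zprimitive; split.
- by rewrite Esz sz ltnS dvdn_leq // adim_gt0.
- case: (pselect (exists i, ~~ (p %| (zprimitive q)`_i)%Z)) => // nex.
  have : (p %| zcontents (zprimitive q))%Z.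
    rewrite dvdz_contents; apply/polyOverP => i.
    by apply/negPn/negP => ni; apply: nex; exists i.
  rewrite zcontents_primitive q0 dvdzE /= dvdn1 => /eqP Ep.
  by move: pp; rewrite Ep.
have z0 : (zcontents q)%:~R != 0 :> K.
  by rewrite nf_intr_eq0 zcontents_eq0.
have a0' : (a%:~R)^-1 != 0 :> K.
  by rewrite invr_eq0 nf_intr_eq0.
apply: (mulfI z0); apply: (mulfI a0'); rewrite !mulr0 -[RHS]mx Eq.
rewrite map_polyZ hornerZ [X in _ = X * _]fmorphV [X in _ = X^-1 * _]rmorph_int;
    congr (_ * _).
rewrite -map_poly_comp (horner_coef_wide (n := size q)); last first.
  exact: leq_trans (size_poly _ _) _.
rewrite mulr_sumr; apply: eq_bigr => i _.
have Ei : q`_i = zcontents q * (zprimitive q)`_i by rewrite {1}[q]zpolyEprim coefZ.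
by rewrite coef_map /= int_alg Ei intrM mulrA.
Qed.

(* [g0 + g1 z + g2 z^2 + g3 z^3] has no zero on the projective line over F_3,
   hence is irreducible over the rationals; and 3 does not divide 4. *)
Lemma cubic_no_root (g0 g1 g2 g3 : int) (z : K) : \dim {:K} = 4%N ->
  (forall a b : 'F_3, g0%:~R * b ^+ 3 + g1%:~R * a * b ^+ 2 + g2%:~R * a ^+ 2 * b
     + g3%:~R * a ^+ 3 = 0 -> a = 0 /\ b = 0) ->
  g0%:~R + g1%:~R * z + g2%:~R * z ^+ 2 + g3%:~R * z ^+ 3 != 0.
Proof.
move=> dimK irr; apply/eqP => gz.
have norat (x : rat) : g0%:~R + g1%:~R * x + g2%:~R * x ^+ 2 + g3%:~R * x ^+ 3 != 0.
  rewrite -(divq_num_den x); apply/eqP => E.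
  have : g0 * denq x ^+ 3 + g1 * numq x * denq x ^+ 2 + g2 * numq x ^+ 2 * denq x
     + g3 * numq x ^+ 3 = 0.
    apply/eqP; rewrite -(intr_eq0 rat) !(rmorphD, rmorphM, rmorphXn) /=.
    apply/eqP/(mulIf (x := ((denq x)%:~R ^- 3))).
      by rewrite invr_eq0 expf_eq0 intr_eq0 denq_eq0.
    rewrite mul0r -[RHS]E; field.
    by rewrite intr_eq0 denq_eq0.
  move/(congr1 (fun n : int => n%:~R : 'F_3)); rewrite !(rmorphD, rmorphM, rmorphXn)
      /= => H.
  have [a0 b0] := irr _ _ H.
  have dv (n : int) : n%:~R = 0 :> 'F_3 -> (3 %| `|n|)%N.
    move=> n0; suff : (3%:Z %| n)%Z by rewrite dvdzE.
    by rewrite (dvdz_pcharf (pchar_Fp (isT : prime 3))); apply/eqP.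
  by have := coprime_num_den x; rewrite /coprime -dvdn1 => /(dvdn_trans _); move/(_
      3); rewrite dvdn_gcd !dv // => /(_ isT).
have [m [sz m0 dm mx mdv]] := rat_minimal_polynomial z.
pose g : {poly rat} := \poly_(i < 4) nth 0 [:: g0%:~R; g1%:~R; g2%:~R; g3%:~R] i.
have gE (x : rat) : g.[x] = g0%:~R + g1%:~R * x + g2%:~R * x ^+ 2 + g3%:~R * x ^+ 3.
  by rewrite horner_poly !big_ord_recr big_ord0 /= add0r expr0 mulr1 expr1.
have mg : m %| g.
  apply: mdv; rewrite -[RHS]gz (horner_coef_wide (n := 4)) ?size_map_poly ?size_poly //.
  rewrite !big_ord_recr big_ord0 /= !coef_map !coef_poly /= add0r expr0 mulr1 expr1.
  by rewrite !int_alg.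
have g3N : g3 != 0.
  apply/eqP => E; have [] := irr 1 0; last by move/eqP; rewrite oner_eq0.
  by rewrite E !expr0n /= !mulr0 mul0r !addr0.
have sg : size g = 4%N.
  by apply: size_poly_eq; rewrite /= intr_eq0.
have g0' : g != 0 by rewrite -size_poly_gt0 sg.
have le3 : ((size m).-1 < 4)%N.
  by rewrite -sz -sg dvdp_leq.
(* The degree of m divides 4 and is at most 3, so it is 1 or 2: m is a proper factor of the cubic,
   which therefore has a rational root. *)
rewrite dimK in dm.
have szm : (1 < size m < size g)%N.
  by rewrite sg sz; move: dm m0 le3; case: (_.-1) => [|[|[|[|]]]].
have [r] := reducible_cubic_root (size_poly _ _) szm mg.
by rewrite /root gE (negPf (norat r)).
Qed.
End NumberField.

(** * The curve at the prime 2 *)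

Definition x1_11 (K : fieldType) (x y : K) : Prop := y ^+ 2 + y = x ^+ 3 - x ^+ 2.

(** On C this is (2 y + 1)^2; its roots are the abscissae of the points of order 2. *)
Definition dblden (K : fieldType) (x : K) : K := 4%:R * x ^+ 3 - 4%:R * x ^+ 2 + 1.

Definition dbl (K : fieldType) (x : K) : K := (x ^+ 4 - 2%:R * x + 1) / dblden x.

Section Dyadic.
Variables (K : fieldExtType rat) (V : K -> Prop).
Hypothesis dimK : \dim {:K} = 4%N.
Hypothesis vV : valring 2 V.
Let sV : subring V := vr_subring vV.
Local Notation M := (nonunit V).

(** An integral relation of degree at most 4, with some odd coefficient, reduces to a nonzero
    polynomial over F_2 killing the residue of a. *)
Lemma residue_field_16_or_8 a : V a -> M (a ^+ 16 - a) \/ M (a ^+ 8 - a).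
Proof.
move=> Va; have [c [sc [i ci] Ec]] := int_relation a (isT : prime 2).
rewrite dimK in sc.
apply: (residue_degree4 vV (e := fun i => ~~ (2 %| c`_i)%Z)) => //; last first.
  have li : (i < size c)%N.
    by rewrite ltnNge; apply: contraNN ci => le; rewrite nth_default // dvdz0.
  by exists (Ordinal (leq_trans li sc)).
have Ec5 : \sum_(i < 5) (c`_i)%:~R * a ^+ i = 0.
  rewrite -[RHS]Ec (big_ord_widen 5 (fun i => (c`_i)%:~R * a ^+ i) sc).
  rewrite [RHS]big_mkcond; apply: eq_bigr => j _; case: ltnP => // le.
  by rewrite nth_default // mul0r.
suff : M (\sum_(i < 5) ((~~ (2 %| c`_i)%Z)%:R * a ^+ i - (c`_i)%:~R * a ^+ i)).
  by rewrite sumrB Ec5 subr0.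
have M0 := nonunit0 V.
elim/big_ind: _ => // [u v|j _]; first exact: (nonunitD vV).
rewrite -mulrBl; apply: (nonunitMl vV); last exact: (subringX sV).
set n := c`_j.
have -> : (~~ (2 %| n)%Z)%:R = (n %% 2)%Z%:~R :> K.
  rewrite (sameP dvdz_mod0P eqP).
  have := modz_ge0 n (isT : (2 : int) != 0).
  have := ltz_pmod n (isT : (0 < 2 :> int)%R).
  by case: (n %% 2)%Z => // -[|[|]].
rewrite [X in _ - X%:~R](divz_eq n 2); move: (n %% 2)%Z (n %/ 2)%Z => r q.
rewrite intrD intrM opprD addrCA subrr addr0.
apply: (nonunitN vV); apply: (nonunitMr vV); first exact: (subring_int sV).
exact: (nonunit_p vV).
Qed.

Lemma frobenius_add n a b : V a -> V b ->
  M ((a + b) ^+ (2 ^ n) - a ^+ (2 ^ n) - b ^+ (2 ^ n)).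
Proof.
move=> Va Vb; elim: n => [|n IH].
  have -> : (a + b) ^+ (2 ^ 0) - a ^+ (2 ^ 0) - b ^+ (2 ^ 0) = 0 by rewrite expn0; ring.
  by left.
rewrite expnSr !exprM; move: IH.
set s := (a + b) ^+ _; set u := a ^+ _; set v := b ^+ _ => IH.
have Vs : V s by apply: (subringX sV); exact: (subringD sV).
have Vu : V u by exact: (subringX sV).
have Vv : V v by exact: (subringX sV).
apply: (nonunit_mod2 vV (g := s + u + v) (h := u * v) IH); [in_valring sV..|by ring].
Qed.

(** If one residue lies in F_16 and the other in F_8, their sum lies in one of these fields, and
    then so do both residues. *)
Lemma residue_field_pair x y : V x -> V y ->
  M (x ^+ 16 - x) /\ M (y ^+ 16 - y) \/ M (x ^+ 8 - x) /\ M (y ^+ 8 - y).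
Proof.
move=> Vx Vy.
have tate_r n : M ((x + y) ^+ (2 ^ n) - (x + y)) ->
  (M (x ^+ (2 ^ n) - x) <-> M (y ^+ (2 ^ n) - y)).
  move=> H; have F := frobenius_add n Vx Vy; split=> H'.
    have -> : y ^+ (2 ^ n) - y = ((x + y) ^+ (2 ^ n) - (x + y))
      - ((x + y) ^+ (2 ^ n) - x ^+ (2 ^ n) - y ^+ (2 ^ n)) - (x ^+ (2 ^ n) - x) by ring.
    by do 2!apply: (nonunitB vV) => //.
  have -> : x ^+ (2 ^ n) - x = ((x + y) ^+ (2 ^ n) - (x + y))
      - ((x + y) ^+ (2 ^ n) - x ^+ (2 ^ n) - y ^+ (2 ^ n)) - (y ^+ (2 ^ n) - y) by ring.
  by do 2!apply: (nonunitB vV) => //.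
case: (residue_field_16_or_8 Vx) => Hx; case: (residue_field_16_or_8 Vy) => Hy; auto.
  by case: (residue_field_16_or_8 (subringD sV Vx Vy)) => [/(tate_r 4)|/(tate_r 3)]
      [H1 H2]; auto.
by case: (residue_field_16_or_8 (subringD sV Vx Vy)) => [/(tate_r 4)|/(tate_r 3)] [H1
    H2]; auto.
Qed.

Lemma x1_11_y_in x y : x1_11 x y -> V x -> V y.
Proof.
move=> C Vx; apply: contrapT => nVy; have Mv := notin_nonunit nVy.
have y0 : y != 0 by apply: contra_notN nVy => /eqP ->; exact: (subring0 sV).
apply: (nonunit1 vV).
have -> : 1 = y^-1 * (y^-1 * (x ^+ 3 - x ^+ 2) - 1) by rewrite -C; field.
by apply: (nonunitMl vV) => //; have Vv := nonunit_in vV Mv; in_valring sV.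
Qed.

(* Modulo 2, [y^2 = w - y] gives [y^8 = w^4 + w^2 + w - y] and
   [y^16 = w^8 + w^4 + w^2 + w - y] with [w = x^3 - x^2]. *)
Lemma x1_11_trace x y : x1_11 x y -> V x -> let w := x ^+ 3 - x ^+ 2 in
  M (y ^+ 8 - (w ^+ 4 + w ^+ 2 + w - y)) /\
  M (y ^+ 16 - (w ^+ 8 + w ^+ 4 + w ^+ 2 + w - y)).
Proof.
move=> C Vx w; have Vy := x1_11_y_in C Vx.
have Vw : V w by rewrite /w; in_valring sV.
have E2 : y ^+ 2 = w - y by rewrite /w -C; ring.
have step n u : V u -> M (y ^+ n - (u - y)) -> M (y ^+ (n * 2) - (u ^+ 2 + w - y)).
  move=> Vu H; rewrite exprM.
  apply: (nonunit_mod2 vV (g := y ^+ n + u - y) (h := - (u * y)) H); [in_valring sV..|].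
  have -> : w = y ^+ 2 + y by rewrite E2; ring.
  by ring.
have M0 := nonunit0 V.
have H4 : M (y ^+ 4 - (w ^+ 2 + w - y)) by apply: (step 2%N) => //; rewrite E2 subrr.
have H8 : M (y ^+ 8 - (w ^+ 4 + w ^+ 2 + w - y)).
  have V2 : V (w ^+ 2 + w) by in_valring sV.
  apply: (nonunit_mod2 vV (g := 1) (h := w ^+ 3) (step 4%N _ V2 H4)); [in_valring
      sV..|by ring].
split=> //.
have V4 : V (w ^+ 4 + w ^+ 2 + w) by in_valring sV.
apply: (nonunit_mod2 vV (g := 1) (h := w ^+ 6 + w ^+ 5 + w ^+ 3) (step 8%N _ V4 H8));
    [in_valring sV..|by ring].
Qed.

Lemma nonunit_frobenius4 x : V x -> M (1 + x + x ^+ 2) -> M (x ^+ 16 - x).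
Proof.
move=> Vx H.
apply: (nonunit_mod2 vV (g := (x ^+ 2 - x) * (1 + x ^+ 3 + x ^+ 6 + x ^+ 9 + x ^+
    12)) (h := 0) H);
    [by in_valring sV..|by ring].
Qed.

(** If both residues are in F_8, then y^8 = y forces w + w^2 + w^4 = 0 for w = x^3 - x^2. Using x^8
    = x this becomes x (1 + x) (1 + x + x^2)^2 = 0, so the residue of x lies in F_4. *)
Lemma x1_11_residue x y : x1_11 x y -> V x -> M (x ^+ 16 - x).
Proof.
move=> C Vx; have Vy := x1_11_y_in C Vx.
case: (residue_field_pair Vx Vy) => [[]//|[H8x H8y]].
have [Hy _] := x1_11_trace C Vx; move: Hy; set w := x ^+ 3 - x ^+ 2 => Hy.
have Ht : M (x * ((1 + x) * (1 + x + x ^+ 2) ^+ 2)).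
  have Hs : M (w ^+ 4 + w ^+ 2 + w).
    apply: (nonunit_mod2 vV (g := 1) (h := y) (nonunitB vV H8y Hy)); [in_valring
        sV..|by ring].
  have Hs' : M (w ^+ 4 + w ^+ 2 + w - (x ^+ 8 - x) * (1 + x ^+ 4)).
    by apply: (nonunitB vV) => //; apply: (nonunitMl vV) => //; in_valring sV.
  apply: (nonunit_mod2 vV (g := 1) (h := 2%:R * (x ^+ 2 + x ^+ 3 + x ^+ 4 + x ^+ 5 +
      x ^+ 9)
     - 3%:R * x ^+ 10 + 2%:R * x ^+ 11) Hs'); [in_valring sV..|by rewrite /w; ring].
have H0 : M x -> M (x ^+ 16 - x).
  move=> Mx; have -> : x ^+ 16 - x = x * (x ^+ 15 - 1) by ring.
  by apply: (nonunitMl vV) => //; in_valring sV.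
case/(nonunit_prime vV): Ht => [||/H0|] //; first by in_valring sV.
case/(nonunit_prime vV) => [||H1|]; [by in_valring sV..| |].
  have -> : x ^+ 16 - x = (1 + x) * (x * (\sum_(i < 15) x ^+ i)) - 2%:R * (x *
      (\sum_(i < 15) x ^+ i)).
    by rewrite !big_ord_recr big_ord0 /=; ring.
  have Vs : V (\sum_(i < 15) x ^+ i) by apply: (subring_sum sV) => // i; exact:
      (subringX sV).
  by apply: (nonunitB vV) => //; apply: (nonunitMl vV) => //; try exact: (subringM
      sV); exact: (nonunit_p vV).
by move/(expr_nonunit vV (n := 2) isT); exact: nonunit_frobenius4.
Qed.

(** Modulo 2 the polynomial 1 + X + X^4 is the 3-division polynomial. In F_16, y^16 = y makes the
    trace of w = x^3 - x^2 vanish, whereas it is 1 modulo 1 + X + X^4; in F_8, X^8 - X is coprime to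
    1 + X + X^4. *)
Lemma x1_11_not_3torsion x y : x1_11 x y -> V x -> ~ M (1 + x + x ^+ 4).
Proof.
move=> C Vx H; have Vy := x1_11_y_in C Vx; apply: (nonunit1 vV).
have [_] := x1_11_trace C Vx; set w := x ^+ 3 - x ^+ 2 => Hy.
case: (residue_field_pair Vx Vy) => [[_ Hy']|[Hx _]].
  have Hs : M (w ^+ 8 + w ^+ 4 + w ^+ 2 + w).
    apply: (nonunit_mod2 vV (g := 1) (h := y) (nonunitB vV Hy' Hy)); [rewrite /w;
        in_valring sV..|by ring].
  have Vg : V (1 + x + x ^+ 3 + x ^+ 4 + x ^+ 6 + x ^+ 10 + x ^+ 11 + x ^+ 14 + x ^+
      16 + x ^+ 17 + x ^+ 20).
    by in_valring sV.
  have := nonunitB vV Hs (nonunitMl vV H Vg) => Hd.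
  apply: (nonunit_mod2 vV (g := 1) (h := - (- 1 - x - x ^+ 2 - x ^+ 4 - 2%:R * x ^+ 5
      - x ^+ 7 - 2%:R * x ^+ 9 + 2%:R * x ^+ 10 - 3%:R * x ^+ 11 - x ^+ 14 - x ^+ 15
      - 5%:R * x ^+ 17 + 13%:R * x ^+ 18 - 28%:R * x ^+ 19 + 34%:R * x ^+ 20 - 29%:R
      * x ^+ 21 + 14%:R * x ^+ 22 - 4%:R * x ^+ 23)) Hd);
   [in_valring sV..|by rewrite /w; ring].
have H3 : M (1 + x + x ^+ 2).
  have Hd : M (x ^+ 8 - x - (1 + x + x ^+ 4) * (x ^+ 4 - x - 1)).
    by apply: (nonunitB vV) => //; apply: (nonunitMl vV) => //; in_valring sV.
  apply: (nonunit_mod2 vV (g := 1) (h := 0) Hd); [in_valring sV..|].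
  by ring.
have Hd : M (1 + x + x ^+ 4 - (1 + x + x ^+ 2) * (x ^+ 2 - x)).
  by apply: (nonunitB vV) => //; apply: (nonunitMl vV) => //; in_valring sV.
apply: (nonunit_mod2 vV (g := 1) (h := - x) Hd); [in_valring sV..|by ring].
Qed.

End Dyadic.

(** * Ramification at 11 *)

Section Ramification.
Variables (K : fieldExtType rat) (p : nat) (V : K -> Prop).
Hypothesis pp : prime p.
Hypothesis vV : valring p V.
Let sV : subring V := vr_subring vV.
Local Notation M := (nonunit V).

(** Here t^n is p times a unit. If n exceeded the degree, take in an integral relation for t the
    least i with c_i prime to p: every other term lies in t^i times the maximal ideal, the later
    ones by their power of t, the earlier ones because p divides c_j and p is t^n times a unit. Then
    c_i is a nonunit. *)
Lemma ramification_degree n (t : K) : t != 0 ->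
  V (t ^+ n / p%:R) -> V (t ^+ n / p%:R)^-1 -> (n <= \dim {:K})%N.
Proof.
have p0 : p%:R != 0 :> K by rewrite nf_natr_eq0 -lt0n prime_gt0.
move=> t0; case: n => // n Vu Vu'; rewrite leqNgt; apply/negP => dimK.
set u := _ / _ in Vu Vu'.
have tn : t ^+ n.+1 = p%:R * u by rewrite /u mulrC divfK.
have u0 : u != 0 by rewrite mulf_neq0 ?invr_eq0 ?expf_neq0.
have Mt : M t.
  apply: (expr_nonunit vV (n := n.+1)) => //; rewrite tn.
  by apply: (nonunitMl vV) => //; exact: (nonunit_p vV).
have Vt := nonunit_in vV Mt.
have [c [sc exc Ec]] := int_relation t pp.
have [i nci mini] := ex_minnP exc.
have li : (i < size c)%N.
  by rewrite ltnNge; apply: contraNN nci => le; rewrite nth_default // dvdz0.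
move: Ec; rewrite (bigD1 (Ordinal li)) //= => /eqP.
have [m Mm ->] : exists2 m, M m &
    \sum_(j < size c | j != Ordinal li) (c`_j)%:~R * t ^+ j = t ^+ i * m.
  elim/big_ind: _ => [|_ _ [m Mm ->] [m' Mm' ->]|j nj].
  - by exists 0; [left|rewrite mulr0].
  - by exists (m + m'); [exact: (nonunitD vV)|rewrite mulrDr].
  have {}nj : (j != i :> nat) by [].
  case: (ltngtP j i) nj => // [ltji|ltij] _; last first.
    exists ((c`_j)%:~R * t ^+ (j - i)); last by rewrite mulrCA -exprD subnKC // ltnW.
    apply: (nonunitMr vV); first exact: (subring_int sV).
    by apply: (nonunit_expr vV) => //; rewrite subn_gt0.
  have /dvdzP[d ->] : (p %| c`_j)%Z.
    by apply/negPn/negP => /mini; rewrite leqNgt ltji.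
  exists (d%:~R * u^-1 * t ^+ (n.+1 + j - i)).
    apply: (nonunitMr vV); first by apply: (subringM sV) => //; exact: (subring_int sV).
    by apply: (nonunit_expr vV) => //; rewrite subn_gt0; move: li sc dimK; lia.
  rewrite mulrCA -exprD subnKC; last by move: li sc dimK; lia.
  by rewrite exprD tn intrM -pmulrn; field.
rewrite mulrC -mulrDr mulf_eq0 expf_eq0 (negPf t0) andbF /= addr_eq0 => /eqP cm.
move/negP: nci; apply; apply: (int_nonunit vV) => //.
by rewrite cm; exact: (nonunitN vV).
Qed.
End Ramification.

(* The roots of this factor of the 5-division polynomial, shifted by 3, have valuation 1/5 or 2/5 at 11: the Newton
   polygon of the shifted polynomial has vertices (0, 3), (5, 1) and (10, 0). *)
Lemma five_torsion_no_root (K : fieldExtType rat) (z : K) : \dim {:K} = 4%N ->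
  5%:R * z ^+ 10 - 15%:R * z ^+ 9 + z ^+ 8 + 96%:R * z ^+ 7 - 189%:R * z ^+ 6
  + 171%:R * z ^+ 5 - 84%:R * z ^+ 4 + 10%:R * z ^+ 3 + 25%:R * z ^+ 2
  - 20%:R * z + 5%:R != 0.
Proof.
move=> dimK; apply/eqP => hz.
have q0 : 11%:R != 0 :> K by rewrite nf_natr_eq0.
have [V vV] := nf_valring_exists K (isT : prime 11).
have sV := vr_subring vV.
have Mq := nonunit_p vV.
have nM (n : int) : ~~ (11 %| n)%Z -> ~ nonunit V n%:~R.
  by move=> nn /(int_nonunit vV (isT : prime 11)); apply/negP.
have ram (t : K) : t != 0 -> V (t ^+ 5 / 11%:R) -> V (t ^+ 5 / 11%:R)^-1 -> False.
  by move=> t0 V1 V2; have := ramification_degree (isT : prime 11) vV t0 V1 V2;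
      rewrite dimK.
pose t := z + 3%:R.
have : - 151%:R * 11%:R ^+ 3 + 784%:R * 11%:R ^+ 3 * t - 1433%:R * 11%:R ^+ 3 * t ^+ 2
  + 15320%:R * 11%:R ^+ 2 * t ^+ 3 - 9186%:R * 11%:R ^+ 2 * t ^+ 4
  + 39915%:R * 11%:R * t ^+ 5 - 10647%:R * 11%:R * t ^+ 6 + 1908%:R * 11%:R * t ^+ 7
  - 221%:R * 11%:R * t ^+ 8 + 15%:R * 11%:R * t ^+ 9 - 5%:R * t ^+ 10 = 0.
  by rewrite /t -[RHS]oppr0 -hz; ring.
move=> Et.
have t0 : t != 0.
  apply/eqP => t0; rewrite t0 in Et.
  have /eqP : (151 * 1331)%:R = 0 :> K by rewrite -[RHS]oppr0 -Et; ring.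
  by rewrite nf_natr_eq0.
(* Replacing 11 by a variable keeps the powers of the prime visible in the coefficients. *)
move: ram Mq q0 Et; move: 11%:R => q ram Mq q0 Et.
have Vq := nonunit_in vV Mq.
have M5 : ~ nonunit V 5%:R by apply: (nM 5).
have Vt : V t.
  apply: contrapT => /notin_nonunit; set w := t^-1 => Mw; apply: M5.
  have -> : 5%:R = w * (15%:R * q - 221%:R * q * w + 1908%:R * q * w ^+ 2
      - 10647%:R * q * w ^+ 3 + 39915%:R * q * w ^+ 4 - 9186%:R * q ^+ 2 * w ^+ 5
      + 15320%:R * q ^+ 2 * w ^+ 6 - 1433%:R * q ^+ 3 * w ^+ 7
      + 784%:R * q ^+ 3 * w ^+ 8 - 151%:R * q ^+ 3 * w ^+ 9).
    have h : t ^+ 10 != 0 by rewrite expf_neq0.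
    by apply: (mulIf h); rewrite -[LHS]addr0 -Et /w; field.
  by apply: (nonunitMl vV) => //; have Vw := nonunit_in vV Mw; in_valring sV.
(* With v(q) = 1, [A] and [C = A / q] compare v(t) with 1/5 and 2/5. Away from these two values one
   term of the equation dominates, with coefficient 5, 39915 or 151 prime to 11. *)
pose A := t ^+ 5 / q.
have A0 : A != 0 by rewrite mulf_neq0 ?invr_eq0 ?expf_neq0.
case: (pselect (V A)) => [VA|]; last first.
  move/notin_nonunit; set B := A^-1 => MB; apply: M5.
  have -> : 5%:R = B * (15%:R * t ^+ 4 - 221%:R * t ^+ 3 + 1908%:R * t ^+ 2
      - 10647%:R * t + 39915%:R + (15320%:R * t ^+ 3 - 9186%:R * t ^+ 4) * B
      + (784%:R * t - 1433%:R * t ^+ 2 - 151%:R) * q * B).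
    have h : t ^+ 10 != 0 by rewrite expf_neq0.
    by apply: (mulIf h); rewrite -[LHS]addr0 -Et /B /A; field; apply/andP.
  by apply: (nonunitMl vV) => //; have VB := nonunit_in vV MB; in_valring sV.
case: (pselect (V A^-1)) => [VA'|nVA']; first exact: (ram t).
have MA : nonunit V A by right.
have Mt : nonunit V t.
  apply: (expr_nonunit vV (n := 5)) => //.
  have -> : t ^+ 5 = A * q by rewrite /A divfK.
  exact: (nonunitMl vV).
pose C := A / q.
have C0 : C != 0 by rewrite mulf_neq0 ?invr_eq0.
case: (pselect (V C)) => [VC|]; last first.
  move/notin_nonunit; set D := C^-1 => MD.
  have VD := nonunit_in vV MD.
  (* Here 1/5 < v(t) < 2/5, so the terms in t^4 and t^3 have larger valuation than the one in
     t^5. *)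
  have M4 : nonunit V (q / t).
    apply: (expr_nonunit vV (n := 5)) => //.
    have -> : (q / t) ^+ 5 = D * q ^+ 3 by rewrite /D /C /A; field; apply/andP.
    by apply: (nonunitMl vV) => //; in_valring sV.
  have M3 : nonunit V (q / t ^+ 2).
    apply: (expr_nonunit vV (n := 5)) => //.
    have -> : (q / t ^+ 2) ^+ 5 = D * (D * q) by rewrite /D /C /A; field; apply/andP.
    by apply: (nonunitMl vV) => //; in_valring sV.
  apply: (nM 39915%N) => //; rewrite -pmulrn.
  have -> : 39915%:R = t * (10647%:R - 1908%:R * t + 221%:R * t ^+ 2 - 15%:R * t ^+ 3)
      + A * 5%:R + q / t * 9186%:R - q / t ^+ 2 * 15320%:R
      + D * (1433%:R * t ^+ 2 - 784%:R * t + 151%:R).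
    have h : q * t ^+ 5 != 0 by rewrite mulf_neq0 ?expf_neq0.
    by apply: (mulIf h); rewrite -[LHS]subr0 -Et /D /C /A; field; apply/andP.
  do 4?[apply: (nonunitB vV) || apply: (nonunitD vV)]; by apply: (nonunitMl vV) =>
      //; in_valring sV.
case: (pselect (V C^-1)) => [VC'|nVC'].
  (* When v(t) = 2/5, the element t^3 / q has valuation 1/5. *)
  have E : (t ^+ 3 / q) ^+ 5 / q = C ^+ 3 by rewrite /C /A; field.
  apply: (ram (t ^+ 3 / q)); first by rewrite mulf_neq0 ?invr_eq0 ?expf_neq0.
    by rewrite E; exact: (subringX sV).
  by rewrite E -exprVn; exact: (subringX sV).
have MC : nonunit V C by right.
have M3 : nonunit V (t ^+ 3 / q).
  apply: (expr_nonunit vV (n := 5)) => //.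
  have -> : (t ^+ 3 / q) ^+ 5 = C * (C ^+ 2 * q) by rewrite /C /A; field.
  by apply: (nonunitMl vV) => //; in_valring sV.
apply: (nM 151%N) => //; rewrite -pmulrn.
have -> : 151%:R = t * (784%:R - 1433%:R * t) + t ^+ 3 / q * (15320%:R - 9186%:R * t)
   + C * (39915%:R - 10647%:R * t + 1908%:R * t ^+ 2 - 221%:R * t ^+ 3
   + 15%:R * t ^+ 4 - 5%:R * q * C).
  have h : q ^+ 3 != 0 by rewrite expf_neq0.
  by apply: (mulIf h); rewrite -[LHS]addr0 -Et /C /A; field.
do 2?[apply: (nonunitD vV)]; by apply: (nonunitMl vV) => //; in_valring sV.
Qed.

(** * Dynamics of duplication *)

Section DuplicationDyadic.
Variables (K : fieldType) (V : K -> Prop).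
Hypothesis vV : valring 2 V.
Let sV : subring V := vr_subring vV.
Local Notation M := (nonunit V).

Lemma dblden_unit x : V x -> dblden x != 0 /\ V (dblden x)^-1.
Proof.
move=> Vx; have -> : dblden x = 1 + 2%:R * (2%:R * x ^+ 3 - 2%:R * x ^+ 2).
  by rewrite /dblden; ring.
have Mm : M (2%:R * (2%:R * x ^+ 3 - 2%:R * x ^+ 2)).
  by apply: (nonunitMl vV); [exact: (nonunit_p vV)|in_valring sV].
split; last exact: (unit_add1 vV).
apply/eqP => E; apply: (nonunit1 vV).
by rewrite -[1](addrK (2%:R * (2%:R * x ^+ 3 - 2%:R * x ^+ 2))) E; exact: (nonunitB
    vV (nonunit0 V)).
Qed.

Lemma dbl_in x : V x -> V (dbl x).
Proof. by move=> Vx; have [_ Vd] := dblden_unit Vx; rewrite /dbl; in_valring sV. Qed.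

Lemma dbl_mod2 x : V x -> M (dbl x - (x ^+ 4 + 1)).
Proof.
move=> Vx; have [d0 Vd] := dblden_unit Vx.
have -> : dbl x - (x ^+ 4 + 1) =
    2%:R * ((- x - (x ^+ 4 + 1) * (2%:R * x ^+ 3 - 2%:R * x ^+ 2)) * (dblden x)^-1).
  by rewrite /dbl; move: d0; rewrite /dblden => d0; field.
by apply: (nonunitMl vV); [exact: (nonunit_p vV)|in_valring sV].
Qed.

(** Modulo 2 the composite is (x^4 + 1)^4 + 1, that is x^16. *)
Lemma dbl_dbl_mod2 x : V x -> M (x ^+ 16 - x) -> M (dbl (dbl x) - x).
Proof.
move=> Vx H; set u := dbl x; have Vu : V u by exact: dbl_in.
have H1 := dbl_mod2 Vx; have H2 := dbl_mod2 Vu; rewrite -/u in H1.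
set v := dbl u in H2 *; have Vv : V v by exact: dbl_in.
have -> : v - x = (v - (u ^+ 4 + 1)) + (u - (x ^+ 4 + 1)) *
    ((u + (x ^+ 4 + 1)) * (u ^+ 2 + (x ^+ 4 + 1) ^+ 2)) + (x ^+ 16 - x)
    + 2%:R * (2%:R * x ^+ 12 + 3%:R * x ^+ 8 + 2%:R * x ^+ 4 + 1) by ring.
apply: (nonunitD vV); last by apply: (nonunitMl vV); [exact: (nonunit_p
    vV)|in_valring sV].
apply: (nonunitD vV) => //; apply: (nonunitD vV) => //.
by apply: (nonunitMl vV) => //; in_valring sV.
Qed.

(* Multiplication by 2 is purely inseparable in characteristic 2. *)
Lemma dbl_contracting a b : V a -> V b -> M (a - b) ->
  exists2 m, M m & dbl a - dbl b = m * (a - b).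
Proof.
move=> Va Vb Mab; have [a0 Va'] := dblden_unit Va; have [b0 Vb'] := dblden_unit Vb.
exists (((a - b) ^+ 3 + 2%:R * (2%:R * a ^+ 2 * b - a * b ^+ 2 + b ^+ 3 - 1
   + 2%:R * (a ^+ 3 * b ^+ 3 - a ^+ 2 * b ^+ 2 * (a + b) + 2%:R * a * b * (a + b - 1)
   - (a ^+ 2 + a * b + b ^+ 2 - a - b)))) * ((dblden a)^-1 * (dblden b)^-1)).
  apply: (nonunitMl vV); last by in_valring sV.
  apply: (nonunitD vV); first exact: (nonunit_expr vV).
  by apply: (nonunitMl vV); [exact: (nonunit_p vV)|in_valring sV].
by rewrite /dbl; move: a0 b0; rewrite /dblden => a0 b0; field; apply/andP.
Qed.

(** Infinity is an attracting fixed point: with w = 1/x, duplication sends w to w (4 - 4 w + w^3) /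
    (1 - 2 w^3 + w^4), and the factor of w is a nonunit. *)
Lemma dbl_pole x : dblden x != 0 -> ~ V x ->
  ~ V (dbl x) /\ exists2 m, M m & (dbl x)^-1 = m * x^-1.
Proof.
move=> d0 nVx; have Mw := notin_nonunit nVx; have Vw := nonunit_in vV Mw.
have x0 : x != 0 by apply: contra_notN nVx => /eqP ->; exact: (subring0 sV).
move: Mw Vw; set w := x^-1 => Mw Vw.
have w0 : w != 0 by rewrite invr_eq0.
set s := w ^+ 4 - 2%:R * w ^+ 3.
have Ms : M s.
  by apply: (nonunitB vV); [exact: (nonunit_expr vV)|apply: (nonunitMl vV); [exact:
      (nonunit_p vV)|in_valring sV]].
have Vs := unit_add1 vV Ms.
have s0 : 1 + s != 0.
  apply/eqP => E; apply: (nonunit1 vV); rewrite -[1](addrK s) E.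
  exact: (nonunitB vV (nonunit0 V)).
pose m := (w ^+ 3 + 2%:R * (2%:R - 2%:R * w)) * (1 + s)^-1.
have Mm : M m.
  apply: (nonunitMl vV) => //; apply: (nonunitD vV); first exact: (nonunit_expr vV).
  by apply: (nonunitMl vV); [exact: (nonunit_p vV)|in_valring sV].
have Ed : dblden x = (w ^+ 3 + 2%:R * (2%:R - 2%:R * w)) * x ^+ 3.
  by rewrite /dblden /w; field.
have Em : (dbl x)^-1 = m * w.
  rewrite /dbl invf_div; have -> : x ^+ 4 - 2%:R * x + 1 = (1 + s) * x ^+ 4.
    by rewrite /s /w; field.
  by rewrite Ed /m /w; field; rewrite x0 -?/w.
split; last by exists m.
have m0 : m * w != 0.
  rewrite mulf_neq0 // mulf_neq0 ?invr_eq0 //.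
  by move: d0; rewrite Ed mulf_eq0 => /norP[].
move=> Vd; apply: (nonunit1 vV); have -> : 1 = m * w * dbl x.
  by rewrite -Em mulVf // -invr_eq0 Em.
by apply: (nonunitMl vV) => //; apply: (nonunitMl vV).
Qed.

Variable P : K -> Prop.
Hypothesis Pdbl : forall x, P x -> P (dbl x).
Hypothesis Pden : forall x, P x -> dblden x != 0.
Hypothesis Pres : forall x, P x -> V x -> M (x ^+ 16 - x).

(** For integral z the differences f(f(z_k)) - z_k along the orbit are successively multiplied by
    nonunits, yet the n-th equals the first, so they vanish. For nonintegral z the same argument
    applied to 1/z_k is contradictory. *)
Lemma dbl_periodic z n : P z -> (0 < n)%N -> iter n (@dbl K) z = z -> dbl (dbl z) = z.
Proof.
move=> Pz n0 per.
have Pi k : P (iter k (@dbl K) z) by elim: k => //= k; exact: Pdbl.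
case: (pselect (V z)) => [Vz|nVz].
  have Vi k : V (iter k (@dbl K) z) by elim: k => //= k; exact: dbl_in.
  pose d k := dbl (dbl (iter k (@dbl K) z)) - iter k (@dbl K) z.
  have Md k : M (d k) by apply: dbl_dbl_mod2 => //; exact: Pres.
  have [m Mm Em] : exists2 m, (V m /\ (0 < n -> M m)%N) & d n = m * d 0.
    elim: (n) => [|k [m [Vm _] IH]].
      by exists 1; rewrite ?mul1r //; split=> //; exact: (subring1 sV).
    have [m' Mm' E] := dbl_contracting (dbl_in (dbl_in (Vi k))) (Vi k) (Md k).
    exists (m' * m); last by rewrite {1}/d /= E -/(d k) IH mulrA.
    have Mp : M (m' * m) by exact: (nonunitMl vV).
    by split=> // ; exact: (nonunit_in vV).
  have E : d n = d 0 by rewrite /d per.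
  have : (1 - m) * d 0 = 0 by rewrite mulrBl mul1r -Em E subrr.
  move/eqP; rewrite mulf_eq0 => /orP[/eqP/subr0_eq m1|/eqP/subr0_eq //].
  by case: (nonunit1 vV); rewrite m1; case: Mm => _; exact.
have [_ [m [Vm Mm] Em]] : ~ V (iter n (@dbl K) z) /\
    exists2 m, (V m /\ (0 < n -> M m)%N) & (iter n (@dbl K) z)^-1 = m * z^-1.
  elim: (n) => [|k [nV [m [Vm _] IH]]].
    by split=> //; exists 1; rewrite ?mul1r //; split=> //; exact: (subring1 sV).
  have [nV' [m' Mm' E]] := dbl_pole (Pden (Pi k)) nV.
  split=> //; exists (m' * m); last by rewrite /= E IH mulrA.
  have Mp : M (m' * m) by exact: (nonunitMl vV).
  by split=> //; exact: (nonunit_in vV).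
have z0 : z^-1 != 0.
  by rewrite invr_eq0; apply: contra_notN nVz => /eqP ->; exact: (subring0 sV).
case: (nonunit1 vV); have -> : 1 = m by apply: (mulIf z0); rewrite mul1r -Em per.
exact: Mm.
Qed.

End DuplicationDyadic.

(** * Orbits of duplication on C over a quartic field *)

Section Curve.
Variable K : fieldExtType rat.
Hypothesis dimK : \dim {:K} = 4%N.

Lemma dblden_neq0 (x : K) : dblden x != 0.
Proof.
rewrite /dblden; have -> : 4%:R * x ^+ 3 - 4%:R * x ^+ 2 + 1 =
   1%:~R + 0%:~R * x + (-4)%:~R * x ^+ 2 + 4%:~R * x ^+ 3 by ring.
apply: cubic_no_root dimK _.
by move=> [[|[|[|]]] //= ia] [[|[|[|]]] //= ib] //; split; exact: val_inj.
Qed.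

(** C is itself a Weierstrass curve, and [padd] applied to the point and itself has abscissa
    [dbl x]. *)
Lemma x1_11_dbl (x y : K) : x1_11 x y -> exists y', x1_11 (dbl x) y'.
Proof.
rewrite /x1_11 => C; have := dblden_neq0 x => d0.
have E : (2%:R * y + 1) ^+ 2 = dblden x.
  by have -> : (2%:R * y + 1) ^+ 2 = 4%:R * (y ^+ 2 + y) + 1 by [ring]; rewrite C
      /dblden; ring.
have h0 : 2%:R * y + 1 != 0 by move: d0; rewrite -E expf_eq0.
have C0 : oncurve (Weierstrass 0 (-1) 1 0 0) (Some (x, y)).
  apply/eqP => /=; transitivity (y ^+ 2 + y); first by ring.
  by rewrite C; ring.
have := padd_oncurve C0 C0; rewrite /= eqxx /=.
have -> : (y + y + 0 * x + 1 == 0) = false.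
  by apply: negbTE; have -> : y + y + 0 * x + 1 = 2%:R * y + 1 by ring.
set l := _ / _; have -> : l ^+ 2 + 0 * l - -1 - x - x = dbl x.
  apply: (mulIf d0); rewrite /dbl divfK // -{1}E /l.
  have h0' : 2%:R * y + 0 * x + 1 != 0 by rewrite mul0r addr0.
  transitivity ((3%:R * x ^+ 2 - 2%:R * x) ^+ 2 + (1 - 2%:R * x) * dblden x).
    by rewrite -E; field; rewrite ?mul0r ?addr0.
  by rewrite /dblden; ring.
rewrite /=; move: (- (l + 0) * _ - _ - _) => y' /eqP H; exists y'.
transitivity (y' ^+ 2 + 0 * dbl x * y' + 1 * y'); first by ring.
by rewrite H; ring.
Qed.

Lemma dbl_periodic_cusp (x y : K) : x1_11 x y -> dbl (dbl x) = x -> (x == 0) || (x == 1).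
Proof.
move=> C; have d0 := dblden_neq0 x; have d1 := dblden_neq0 (dbl x).
(* The quartic is the 3-division polynomial of C; x (x - 1) times the factor of degree 10 is the
   5-division polynomial. *)
have Pz : x * ((x - 1) * ((3%:R * x ^+ 4 - 4%:R * x ^+ 3 + 3%:R * x - 1) *
  (5%:R * x ^+ 10 - 15%:R * x ^+ 9 + x ^+ 8 + 96%:R * x ^+ 7 - 189%:R * x ^+ 6
  + 171%:R * x ^+ 5 - 84%:R * x ^+ 4 + 10%:R * x ^+ 3 + 25%:R * x ^+ 2
  - 20%:R * x + 5%:R))) = (x - dbl (dbl x)) * (dblden (dbl x) * dblden x ^+ 4).
  pose n := x ^+ 4 - 2%:R * x + 1.
  transitivity (x * dblden x * (4%:R * n ^+ 3 - 4%:R * n ^+ 2 * dblden x + dblden x ^+ 3)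
     - (n ^+ 4 - 2%:R * n * dblden x ^+ 3 + dblden x ^+ 4)).
    by rewrite /n /dblden; ring.
  rewrite mulrBl [X in _ = _ - X * _]/dbl [X in _ = _ - X]mulrA divfK //.
  have nE : n = dbl x * dblden x by rewrite /dbl divfK.
  by rewrite nE [dblden (dbl x)]/dblden; ring.
move=> E; move/eqP: Pz; rewrite E subrr mul0r !mulf_eq0 (negPf (five_torsion_no_root
    x dimK)) orbF subr_eq0.
case/or3P => [->//|->|/eqP psi]; rewrite ?orbT //.
have [V vV] := nf_valring_exists K (isT : prime 2).
have sV := vr_subring vV.
have Vx : V x.
  apply: contrapT => /notin_nonunit; set w := x^-1 => Mw; apply: (nonunit1 vV).
  have Vw := nonunit_in vV Mw.
  have x0 : x != 0.
    by apply: contra_eqN psi => /eqP ->; rewrite !expr0n /= !mulr0 subr0 !add0r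
        oppr_eq0 oner_eq0.
  have -> : 1 = w * (4%:R - 3%:R * w ^+ 2 + w ^+ 3) - 2%:R * 1.
    have h : x ^+ 4 != 0 by rewrite expf_neq0.
    by apply: (mulIf h); rewrite -[LHS]subr0 -psi /w; field.
  apply: (nonunitB vV); apply: (nonunitMl vV) => //; try exact: (nonunit_p vV);
      in_valring sV.
case: (x1_11_not_3torsion dimK vV C Vx).
have -> : 1 + x + x ^+ 4 = 2%:R * (2%:R * x ^+ 3 - x ^+ 4 - x + 1).
  by rewrite -[LHS]subr0 -psi; ring.
by apply: (nonunitMl vV); [exact: (nonunit_p vV)|in_valring sV].
Qed.

(** The numerators of [dbl x] and [dbl x - 1] are x - 1 and x times cubics without zeros over
    F_3. *)
Lemma dbl_noncusp (x : K) : x != 0 -> x != 1 -> (dbl x != 0) && (dbl x != 1).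
Proof.
move=> x0 x1; have d0 := dblden_neq0 x.
have n1 : x ^+ 3 + x ^+ 2 + x - 1 != 0.
  have -> : x ^+ 3 + x ^+ 2 + x - 1 = (-1)%:~R + 1%:~R * x + 1%:~R * x ^+ 2 + 1%:~R *
      x ^+ 3 by ring.
  apply: cubic_no_root dimK _.
  by move=> [[|[|[|]]] //= ia] [[|[|[|]]] //= ib] //; split; exact: val_inj.
have n2 : x ^+ 3 - 4%:R * x ^+ 2 + 4%:R * x - 2%:R != 0.
  have -> : x ^+ 3 - 4%:R * x ^+ 2 + 4%:R * x - 2%:R = (-2)%:~R + 4%:~R * x +
      (-4)%:~R * x ^+ 2 + 1%:~R * x ^+ 3 by ring.
  apply: cubic_no_root dimK _.
  by move=> [[|[|[|]]] //= ia] [[|[|[|]]] //= ib] //; split; exact: val_inj.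
apply/andP; split.
  rewrite /dbl mulf_neq0 ?invr_eq0 //.
  have -> : x ^+ 4 - 2%:R * x + 1 = (x - 1) * (x ^+ 3 + x ^+ 2 + x - 1) by ring.
  by apply: mulf_neq0; rewrite // subr_eq0.
rewrite -subr_eq0; have -> : dbl x - 1 = x * (x ^+ 3 - 4%:R * x ^+ 2 + 4%:R * x -
    2%:R) / dblden x.
  by rewrite /dbl; move: d0; rewrite /dblden => d0; field.
by rewrite !mulf_neq0 ?invr_eq0.
Qed.

Lemma dbl_orbit_injective (x y : K) : x1_11 x y -> x != 0 -> x != 1 ->
  injective (fun n => iter n (@dbl K) x).
Proof.
move=> C x0 x1.
have [V vV] := nf_valring_exists K (isT : prime 2).
pose P (z : K) := (exists y, x1_11 z y) /\ (z != 0) && (z != 1).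
have Pdbl z : P z -> P (dbl z).
  by move=> [[w Cw] /andP[z0 z1]]; split; [exact: x1_11_dbl Cw|exact: dbl_noncusp].
have Pi k : P (iter k (@dbl K) x).
  by elim: k => [|k] /=; [split; [exists y|rewrite x0 x1]|exact: Pdbl].
move=> i j; wlog ltij : i j / (i < j)%N.
  move=> H E; case: (ltngtP i j) => // lt; first exact: (H i j lt E).
  exact/esym/(H j i lt)/esym.
move=> /= E; have [[w Cw] /andP[z0 z1]] := Pi i.
suff /(dbl_periodic_cusp Cw) : dbl (dbl (iter i (@dbl K) x)) = iter i (@dbl K) x.
  by rewrite (negPf z0) (negPf z1).
apply: (dbl_periodic vV Pdbl _ _ (Pi i) (n := (j - i)%N)).
- by move=> z _; exact: dblden_neq0.
- by move=> z [[u Cu] _] Vz; exact: (x1_11_residue dimK vV Cu).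
- by rewrite subn_gt0.
by rewrite -iterD subnK ?(ltnW ltij).
Qed.

End Curve.

(** * Points of order 11 on the Tate normal form *)

Section Collinear.
Variables (F : fieldType) (W : weierstrass F).
Implicit Types p q : F * F.

Definition pneg p : F * F := (p.1, - p.2 - wa1 W * p.1 - wa3 W).

(** The last three equations are Vieta's: substituting y = l x + n in the equation of [W] leaves a
    cubic whose roots, with multiplicity, are the three abscissae. Tangents are thus included, and
    the points lie on [W]. *)
Definition collinear p1 p2 p3 : Prop := exists l n : F,
  [/\ p1.2 = l * p1.1 + n, p2.2 = l * p2.1 + n, p3.2 = l * p3.1 + n,
      wa2 W = l ^+ 2 + wa1 W * l - (p1.1 + p2.1 + p3.1) &
      wa4 W = 2%:R * l * n + wa1 W * n + wa3 W * l
              + (p1.1 * p2.1 + p1.1 * p3.1 + p2.1 * p3.1)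
   /\ wa6 W = n ^+ 2 + wa3 W * n - p1.1 * p2.1 * p3.1].

Lemma collinear_swap12 p1 p2 p3 : collinear p1 p2 p3 -> collinear p2 p1 p3.
Proof.
move=> [l [n [E1 E2 E3 H2 [H4 H6]]]]; exists l, n.
by split=> //; [rewrite H2|split; [rewrite H4|rewrite H6]]; ring.
Qed.

Lemma collinear_swap23 p1 p2 p3 : collinear p1 p2 p3 -> collinear p1 p3 p2.
Proof.
move=> [l [n [E1 E2 E3 H2 [H4 H6]]]]; exists l, n.
by split=> //; [rewrite H2|split; [rewrite H4|rewrite H6]]; ring.
Qed.

Lemma collinear_neg p1 p2 p3 :
  collinear p1 p2 p3 -> collinear (pneg p1) (pneg p2) (pneg p3).
Proof.
move=> [l [n [E1 E2 E3 H2 [H4 H6]]]]; exists (- l - wa1 W), (- n - wa3 W).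
split=> /=; try (by rewrite ?E1 ?E2 ?E3; ring).
  by rewrite {1}H2; ring.
by split; [rewrite {1}H4|rewrite {1}H6]; ring.
Qed.

Lemma pnegK p : pneg (pneg p) = p.
Proof. by case: p => x y; rewrite /pneg /=; congr (_, _); ring. Qed.

Lemma padd_neg p : padd W (Some p) (Some (pneg p)) = None.
Proof.
rewrite /pneg; case: W p => [a1 a2 a3 a4 a6] [x y]; rewrite /= eqxx /=.
by case: eqP => // -[]; ring.
Qed.

Lemma padd_collinear p1 p2 p3 : collinear p1 p2 p3 -> p2 <> pneg p1 ->
  padd W (Some p1) (Some p2) = Some (pneg p3).
Proof.
case: p1 p2 p3 => [x1 y1] [x2 y2] [x3 y3] /=.
rewrite /collinear /pneg; case: W => [a1 a2 a3 a4 a6] /= [l [n [E1 E2 E3 H2 [H4 H6]]]] np.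
case: ifP => [/andP[/eqP Ex /eqP Ey]|nP].
  case: np; rewrite Ex; congr (_, _).
  by apply/eqP; rewrite -subr_eq0 -Ey; apply/eqP; ring.
set l' := if _ then _ else _.
have El : l' = l.
  rewrite /l'; case: eqP nP => [Ex /= /negbT h0|nx _].
    have h0' : 2%:R * y1 + a1 * x1 + a3 != 0.
      apply: contraNneq h0 => h0; rewrite -h0 E1 E2 Ex; apply/eqP; ring.
    apply: (mulIf h0'); rewrite divfK // H4 H2 E1 Ex; ring.
  have h0 : x2 - x1 != 0 by rewrite subr_eq0 eq_sym; apply/eqP.
  by apply: (mulIf h0); rewrite divfK // E1 E2; ring.
by rewrite El; congr (Some (_, _)); rewrite ?E3 ?E1 H2; ring.
Qed.

End Collinear.

Section TateNormalForm.
Variable F : fieldType.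

Definition tate (b c : F) : weierstrass F := Weierstrass (1 - c) (- b) (- b) 0 0.

(* With [x] a point's abscissa and [t = y / x], [r] and [s] are the usual
   parameters of a Tate normal form with a point of order 11. *)
Section Params.
Variables t x : F.

Definition tate_q := t * x.
Definition tate_r := 1 + tate_q.
Definition tate_s := 1 + t.
Definition tate_c := tate_s * tate_q.
Definition tate_b := tate_r * tate_c.

Definition W11 := tate tate_b tate_c.

(* The positive multiples up to 5 of the point (0, 0) of order 11. *)
Definition mult5 : seq (F * F) :=
  [:: (0, 0); (tate_b, tate_b * tate_c); (tate_c, tate_b - tate_c); (tate_r * tate_q,
      tate_r ^+ 2 * (tate_c - tate_r + 1));
      (tate_r * tate_s * t, tate_r * tate_s ^+ 2 * (tate_r - tate_s))].

(** Index 0 holds a default value, since that multiple is the point at infinity; the reversal makes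
    index 11 - k the negative of index k. *)
Definition mult11 (k : nat) : F * F :=
  nth (0, 0) ((0, 0) :: mult5 ++ rev (map (pneg W11) mult5)) k.

End Params.

Variables t x : F.
(** The equation of C with y = t x, divided by x. *)
Hypothesis R : x ^+ 2 = x + t ^+ 2 * x + t.
Hypothesis t0 : t != 0.
Hypothesis s0 : 1 + t != 0.

(* [x] and [1 + t ^+ 2 - x] are conjugate over [F(t)], so this is a norm. *)
Lemma norm_unit (f : F -> F -> F) i j (e : bool) :
  f t x * f t (1 + t ^+ 2 - x) = (-1) ^+ e * t ^+ i * (1 + t) ^+ j -> f t x != 0.
Proof.
move=> E; apply/eqP => f0; move/eqP: E; rewrite f0 mul0r eq_sym !mulf_eq0 signr_eq0.
by rewrite !expf_eq0 (negPf t0) (negPf s0) !andbF.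
Qed.

Local Ltac unit_by f i j e := apply: (@norm_unit f i j e);
  rewrite /= /mult11 /= /tate_b /tate_c /tate_r /tate_s /tate_q; ring : R.

Local Notation xd i j := (fun u v => (mult11 u v j).1 - (mult11 u v i).1).
Local Notation yd i := (fun u v => 2%:R * (mult11 u v i).2 + wa1 (W11 u v) * (mult11
    u v i).1 + wa3 (W11 u v)).

(** Each difference has norm plus or minus t^i (1 + t)^j, with the exponents and sign listed case by
    case, so it vanishes only for t = 0 or t = -1. *)
Lemma mult11_x_neq i j : (0 < i < j)%N -> (j <= 5)%N ->
  (mult11 t x j).1 - (mult11 t x i).1 != 0.
Proof.
case: j => [|[|[|[|[|[|j]]]]]]; rewrite ?ltn0 ?andbF //;
  case: i => [|[|[|[|[|i]]]]] // _ _.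
- unit_by (xd 1%N 2%N) 3%N 3%N true.
- unit_by (xd 1%N 3%N) 3%N 2%N true.
- unit_by (xd 2%N 3%N) 6%N 2%N false.
- unit_by (xd 1%N 4%N) 3%N 1%N true.
- unit_by (xd 2%N 4%N) 5%N 1%N true.
- unit_by (xd 3%N 4%N) 6%N 1%N false.
- unit_by (xd 1%N 5%N) 2%N 3%N false.
- unit_by (xd 2%N 5%N) 3%N 4%N true.
- unit_by (xd 3%N 5%N) 4%N 2%N false.
- unit_by (xd 4%N 5%N) 5%N 1%N true.
Qed.

Lemma mult11_not_2torsion i : (0 < i <= 5)%N -> pneg (W11 t x) (mult11 t x i) <>
    mult11 t x i.
Proof.
move=> i5 E; suff : 2%:R * (mult11 t x i).2 + wa1 (W11 t x) * (mult11 t x i).1 + wa3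
    (W11 t x) != 0.
  case/eqP; have := congr1 snd E; rewrite [LHS]/= => H.
  by rewrite -[RHS](subrr (mult11 t x i).2) -[X in _ = _ - X]H; rewrite /W11 /tate
      /=; ring.
case: i i5 {E} => [|[|[|[|[|[|i]]]]]] // _.
- unit_by (yd 1%N) 3%N 3%N true.
- unit_by (yd 2%N) 6%N 5%N false.
- unit_by (yd 3%N) 8%N 2%N false.
- unit_by (yd 4%N) 7%N 1%N true.
- unit_by (yd 5%N) 6%N 4%N false.
Qed.

Lemma mult11_neg k : (0 < k < 11)%N -> pneg (W11 t x) (mult11 t x k) = mult11 t x (11
    - k).
Proof.
by case: k => [|[|[|[|[|[|[|[|[|[|[|k]]]]]]]]]]] // _; rewrite /mult11 /= ?pnegK.
Qed.

(** Up to sign the indices are at most 5, where abscissae are distinct; hence i = j or i = 11 - j,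
    and the latter would make the point its own negative. *)
Lemma mult11_inj i j : (0 < i < 11)%N -> (0 < j < 11)%N -> mult11 t x i = mult11 t x
    j -> i = j.
Proof.
move=> i11 j11 E; pose red k := if (k <= 5)%N then k else (11 - k)%N.
have xred k : (0 < k < 11)%N -> (mult11 t x (red k)).1 = (mult11 t x k).1.
  by rewrite /red; case: ifP => // _ k11; rewrite -mult11_neg.
have r5 k : (0 < k < 11)%N -> (0 < red k <= 5)%N by rewrite /red; case: (leqP k 5); lia.
have Ex : (mult11 t x (red i)).1 = (mult11 t x (red j)).1 by rewrite !xred // E.
have Er : red i = red j.
  have /andP[i0 i5] := r5 i i11; have /andP[j0 j5] := r5 j j11.
  case: (ltngtP (red i) (red j)) => // lt.
    by have := @mult11_x_neq (red i) (red j); rewrite i0 lt Ex subrr eqxx => /(_ isT j5).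
  by have := @mult11_x_neq (red j) (red i); rewrite j0 lt Ex subrr eqxx => /(_ isT i5).
have [//|Eij] : i = j \/ i = (11 - j)%N.
  by move: Er i11 j11; rewrite /red; case: (leqP i 5); case: (leqP j 5); lia.
have Ej : pneg (W11 t x) (mult11 t x j) = mult11 t x j by rewrite mult11_neg // -Eij.
case: (leqP j 5) => j5; first by case: (@mult11_not_2torsion j) => //; rewrite j5
    andbT; case/andP: j11.
case: (@mult11_not_2torsion (11 - j)%N); first by move: j11 j5; lia.
by rewrite -!mult11_neg // pnegK Ej.
Qed.

(** There are ten triples i <= j <= k with sum 11. Each witness is the slope of the line, with the
    intercept read off at one of the points. *)
Lemma mult11_collinear_sorted i j : (0 < i <= j)%N -> (i + j + j <= 11)%N ->
  collinear (W11 t x) (mult11 t x i) (mult11 t x j) (mult11 t x (11 - (i + j))).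
Proof.
move=> ij sij; have j5 : (j <= 5)%N by lia.
have i3 : (i <= 3)%N by lia.
case: j i j5 i3 ij sij => [|[|[|[|[|[|j]]]]]] [|[|[|[|i]]]] // _ _ _ _; rewrite
    /mult11 /=.
- exists (0), ((mult11 t x 1).2 - (0) * (mult11 t x 1).1).
  by rewrite /mult11 /pneg /= /tate_b /tate_c /tate_r /tate_s /tate_q; split;
      [..|split]; rewrite /=; ring : R.
- exists (tate_q t x * tate_s t), ((mult11 t x 1).2 - (tate_q t x * tate_s t) *
    (mult11 t x 1).1).
  by rewrite /mult11 /pneg /= /tate_b /tate_c /tate_r /tate_s /tate_q; split;
      [..|split]; rewrite /=; ring : R.
- exists (tate_q t x * t + 2%:R * tate_q t x), ((mult11 t x 2).2 - (tate_q t x * t +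
    2%:R * tate_q t x) * (mult11 t x 2).1).
  by rewrite /mult11 /pneg /= /tate_b /tate_c /tate_r /tate_s /tate_q; split;
      [..|split]; rewrite /=; ring : R.
- exists (tate_q t x), ((mult11 t x 1).2 - (tate_q t x) * (mult11 t x 1).1).
  by rewrite /mult11 /pneg /= /tate_b /tate_c /tate_r /tate_s /tate_q; split;
      [..|split]; rewrite /=; ring : R.
- exists (tate_q t x * t + tate_q t x + t), ((mult11 t x 2).2 - (tate_q t x * t +
    tate_q t x + t) * (mult11 t x 2).1).
  by rewrite /mult11 /pneg /= /tate_b /tate_c /tate_r /tate_s /tate_q; split;
      [..|split]; rewrite /=; ring : R.
- exists (tate_q t x + x - 1), ((mult11 t x 3).2 - (tate_q t x + x - 1) * (mult11 t x
    3).1).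
  by rewrite /mult11 /pneg /= /tate_b /tate_c /tate_r /tate_s /tate_q; split;
      [..|split]; rewrite /=; ring : R.
- exists (tate_q t x * t + t), ((mult11 t x 1).2 - (tate_q t x * t + t) * (mult11 t x
    1).1).
  by rewrite /mult11 /pneg /= /tate_b /tate_c /tate_r /tate_s /tate_q; split;
      [..|split]; rewrite /=; ring : R.
- exists (tate_q t x * t + tate_q t x + x - 1), ((mult11 t x 2).2 - (tate_q t x * t +
    tate_q t x + x - 1) * (mult11 t x 2).1).
  by rewrite /mult11 /pneg /= /tate_b /tate_c /tate_r /tate_s /tate_q; split;
      [..|split]; rewrite /=; ring : R.
- exists (tate_q t x * t + t + x - 1), ((mult11 t x 3).2 - (tate_q t x * t + t + x -
    1) * (mult11 t x 3).1).
  by rewrite /mult11 /pneg /= /tate_b /tate_c /tate_r /tate_s /tate_q; split;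
      [..|split]; rewrite /=; ring : R.
- exists (tate_q t x - t + x - 1), ((mult11 t x 1).2 - (tate_q t x - t + x - 1) *
    (mult11 t x 1).1).
  by rewrite /mult11 /pneg /= /tate_b /tate_c /tate_r /tate_s /tate_q; split;
      [..|split]; rewrite /=; ring : R.
Qed.

Lemma mult11_collinear i j k : (0 < i)%N -> (0 < j)%N -> (0 < k)%N -> (i + j + k =
    11)%N ->
  collinear (W11 t x) (mult11 t x i) (mult11 t x j) (mult11 t x k).
Proof.
wlog leij : i j / (i <= j)%N.
  move=> H i0 j0 k0 E; case: (leqP i j) => [le|/ltnW le]; first exact: H.
  by apply: collinear_swap12; apply: H => //; lia.
wlog lejk : i j k leij / (j <= k)%N.
  move=> H i0 j0 k0 E; case: (leqP j k) => [le|/ltnW le]; first exact: H.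
  apply: collinear_swap23; case: (leqP i k) => [leik|/ltnW leki]; first by apply: H
      => //; lia.
  by apply: collinear_swap12; apply: H => //; lia.
move=> i0 j0 k0 E; have -> : k = (11 - (i + j))%N by lia.
by apply: mult11_collinear_sorted; [rewrite i0|lia].
Qed.

(** If i + j < 11 the third point on the line has index 11 - (i + j). Otherwise the collinear triple
    11 - i, 11 - j, i + j - 11 is negated. *)
Lemma padd_mult11 i j : (0 < i < 11)%N -> (0 < j < 11)%N -> (i + j != 11)%N ->
  padd (W11 t x) (Some (mult11 t x i)) (Some (mult11 t x j)) =
  Some (mult11 t x ((i + j) %% 11)).
Proof.
move=> i11 j11 nij; have np : mult11 t x j <> pneg (W11 t x) (mult11 t x i).
  by rewrite mult11_neg // => /mult11_inj E; move/eqP: nij; apply; rewrite E //; lia.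
case: (ltngtP (i + j) 11) nij => // [lt|gt] _.
  rewrite (padd_collinear (p3 := mult11 t x (11 - (i + j)))) //; last first.
    by apply: mult11_collinear; lia.
  by rewrite mult11_neg ?modn_small ?subKn ?(ltnW lt) //; lia.
have -> : ((i + j) %% 11 = i + j - 11)%N.
  by rewrite -{1}(subnK (ltnW gt)) modnDr modn_small //; lia.
rewrite (padd_collinear (p3 := pneg (W11 t x) (mult11 t x (i + j - 11)))) ?pnegK //.
rewrite -[X in collinear _ X](@pnegK _ (W11 t x)) -[X in collinear _ _ X](@pnegK _
    (W11 t x)).
by apply: collinear_neg; rewrite !mult11_neg //; apply: mult11_collinear; lia.
Qed.

Hypothesis quintic0 : t ^+ 5 + t ^+ 4 - 15%:R * t ^+ 3 - 14%:R * t ^+ 2 + 3%:R * t +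
    1 != 0.

(** The discriminant is b^3 c g. The norms of c and r are units as before, and that of g is -t^10
    times the quintic, whose roots belong to the cusps other than the rational ones. *)
Lemma W11_nonsingular : wdisc (W11 t x) != 0.
Proof.
pose g u v := 16%:R * tate_r u v ^+ 2 * tate_c u v - 8%:R * tate_r u v * tate_c u v ^+ 2
  - 20%:R * tate_r u v * tate_c u v + tate_r u v + (tate_c u v - 1) ^+ 3.
have -> : wdisc (W11 t x) = tate_b t x ^+ 3 * (tate_c t x * g t x).
  by rewrite /wdisc /W11 /tate /tate_b /g; ring.
have c0 : tate_c t x != 0.
  by apply: (@norm_unit tate_c 3 2 true); rewrite /tate_c /tate_s /tate_q; ring : R.
have r0 : tate_r t x != 0.
  by apply: (@norm_unit tate_r 0 1 false); rewrite /tate_r /tate_q; ring : R.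
apply: mulf_neq0; first by apply/expf_neq0/mulf_neq0.
apply: mulf_neq0 => //; apply/eqP => g0.
have /eqP : g t x * g t (1 + t ^+ 2 - x) = - (t ^+ 10 *
   (t ^+ 5 + t ^+ 4 - 15%:R * t ^+ 3 - 14%:R * t ^+ 2 + 3%:R * t + 1)).
  by rewrite /g /tate_r /tate_c /tate_s /tate_q; ring : R.
by rewrite g0 mul0r eq_sym oppr_eq0 mulf_eq0 expf_eq0 (negPf t0) (negPf quintic0).
Qed.

Definition E11 : ellcurve F := EllCurve W11_nonsingular.

Definition gen11 (k : nat) : option (F * F) := if k == 0 then None else Some (mult11
    t x k).

Lemma gen11_pos k : (0 < k)%N -> gen11 k = Some (mult11 t x k).
Proof. by rewrite /gen11 => /gtn_eqF ->. Qed.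

Lemma oncurve_gen11 k : (k < 11)%N -> oncurve (W11 t x) (gen11 k).
Proof.
have O1 : oncurve (W11 t x) (gen11 1) by apply/eqP; rewrite /=; ring.
elim: k => [|k IH] k11 //; case: (posnP k) => [->//|k0].
have := padd_oncurve (IH (ltnW k11)) O1.
rewrite !gen11_pos // padd_mult11 ?k0 ?(ltnW k11) //; last first.
  by rewrite addn1 neq_ltn k11.
by rewrite addn1 modn_small.
Qed.

Lemma E11_subgroup : has_subgroup_isog 'Z_11 E11.
Proof.
pose f (a : 'Z_11) : ecpoint E11 := exist _ (gen11 a) (oncurve_gen11 (ltn_ord a)).
have gi (a b : 'Z_11) : gen11 a = gen11 b -> a = b.
  move=> E; apply: val_inj => /=; move: E (ltn_ord a) (ltn_ord b).
  case: (posnP a) => [->|a0]; case: (posnP b) => [->|b0] //; rewrite ?(gen11_pos a0)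
      ?(gen11_pos b0) //.
  by case=> /mult11_inj H la lb; apply: H; apply/andP; split.
exists f => [a b E|a b]; first by apply: gi; exact: (congr1 val E).
apply: val_inj; change (gen11 ((a + b) %% 11)%N = padd (W11 t x) (gen11 a) (gen11 b)).
have la : (a < 11)%N by exact: ltn_ord.
have lb : (b < 11)%N by exact: ltn_ord.
case: (posnP a) => [->|a0]; first by rewrite add0n modn_small.
case: (posnP b) => [->|b0].
  by rewrite addn0 modn_small // gen11_pos //; case: (W11 t x) => ? ? ? ? ?; case:
      (mult11 _ _ _).
rewrite [gen11 a]gen11_pos // [gen11 b]gen11_pos //.
case: (eqVneq (a + b)%N 11%N) => [Eab|nab].
  have -> : nat_of_ord b = (11 - a)%N by move: Eab; clear; move: (nat_of_ord a)
      (nat_of_ord b); lia.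
  by rewrite subnKC ?(ltnW la) // modnn -mult11_neg ?a0 // padd_neg.
rewrite padd_mult11 ?a0 ?b0 // gen11_pos // lt0n.
apply/eqP => /eqP /dvdnP[[|[|m]] E]; move: nab E; lia.
Qed.
End TateNormalForm.

(** * From a point of order 11 to a point of the modular curve *)

Section ChangeOfVariables.
Variables (F : fieldType) (W W' : weierstrass F) (u r s t : F).
Hypothesis u0 : u != 0.
Hypothesis H1 : u * wa1 W' = wa1 W + 2%:R * s.
Hypothesis H2 : u ^+ 2 * wa2 W' = wa2 W - s * wa1 W + 3%:R * r - s ^+ 2.
Hypothesis H3 : u ^+ 3 * wa3 W' = wa3 W + r * wa1 W + 2%:R * t.
Hypothesis H4 : u ^+ 4 * wa4 W' = wa4 W - s * wa3 W + 2%:R * r * wa2 W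
   - (t + r * s) * wa1 W + 3%:R * r ^+ 2 - 2%:R * s * t.

Hypothesis H6 : u ^+ 6 * wa6 W' = wa6 W + r * wa4 W + r ^+ 2 * wa2 W + r ^+ 3
   - t * wa3 W - t ^+ 2 - r * t * wa1 W.

Definition chvar (p : option (F * F)) : option (F * F) :=
  if p is Some (x, y) then Some (u ^+ 2 * x + r, u ^+ 3 * y + u ^+ 2 * s * x + t)
  else None.

Definition chvar_inv (p : option (F * F)) : option (F * F) :=
  if p is Some (x, y) then Some ((x - r) / u ^+ 2, (y - s * (x - r) - t) / u ^+ 3)
  else None.

Lemma chvarK : cancel chvar chvar_inv.
Proof. by move=> [[x y]|] //=; congr (Some (_, _)); field. Qed.

Lemma chvar_invK : cancel chvar_inv chvar.
Proof. by move=> [[x y]|] //=; congr (Some (_, _)); field. Qed.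

Let E1 : wa1 W = u * wa1 W' - 2%:R * s. Proof. by rewrite H1; ring. Qed.
Let E2 : wa2 W = u ^+ 2 * wa2 W' + s * wa1 W - 3%:R * r + s ^+ 2.
Proof. by rewrite H2; ring. Qed.
Let E3 : wa3 W = u ^+ 3 * wa3 W' - r * wa1 W - 2%:R * t. Proof. by rewrite H3; ring. Qed.
Let E4 : wa4 W = u ^+ 4 * wa4 W' + s * wa3 W - 2%:R * r * wa2 W
   + (t + r * s) * wa1 W - 3%:R * r ^+ 2 + 2%:R * s * t.
Proof. by rewrite H4; ring. Qed.
Let E6 : wa6 W = u ^+ 6 * wa6 W' - r * wa4 W - r ^+ 2 * wa2 W - r ^+ 3
   + t * wa3 W + t ^+ 2 + r * t * wa1 W.
Proof. by rewrite H6; ring. Qed.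

Lemma oncurve_chvar p : oncurve W (chvar p) = oncurve W' p.
Proof.
case: p => [[x y]|] //=; rewrite -subr_eq0 -[RHS]subr_eq0.
have h : u ^+ 6 != 0 by rewrite expf_neq0.
rewrite -[RHS](inj_eq (mulfI h)) mulr0; congr (_ == 0).
by rewrite E6 E4 E3 E2 E1; ring.
Qed.

(** Lines go to lines, the slopes being related by l = u l' + s. *)
Lemma padd_chvar p q : oncurve W' p -> oncurve W' q ->
  padd W (chvar p) (chvar q) = chvar (padd W' p q).
Proof.
move: E1 E2 E3 E4.
case: W => a1 a2 a3 a4 a6; case: W' => b1 b2 b3 b4 b6 /= F1 F2 F3 F4.
case: p q => [[x1 y1]|] [[x2 y2]|] //= /eqP C1 /eqP C2.
have -> : (u ^+ 2 * x1 + r == u ^+ 2 * x2 + r) = (x1 == x2).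
  by rewrite (inj_eq (addIr r)) (inj_eq (mulfI _)) // expf_neq0.
case: (eqVneq x1 x2) => [Ex|nx] /=.
  subst x2.
  have -> : u ^+ 3 * y1 + u ^+ 2 * s * x1 + t + (u ^+ 3 * y2 + u ^+ 2 * s * x1 + t)
     + a1 * (u ^+ 2 * x1 + r) + a3 = u ^+ 3 * (y1 + y2 + b1 * x1 + b3).
    by rewrite F3 F1; ring.
  rewrite mulf_eq0 expf_eq0 (negPf u0) /=; case: (eqVneq (_ + b3) 0) => [//|h0].
  have Ey : y2 = y1.
    apply/eqP; rewrite eq_sym -subr_eq0 -(inj_eq (mulIf h0)) mul0r; apply/eqP.
    transitivity ((y1 ^+ 2 + b1 * x1 * y1 + b3 * y1) - (y2 ^+ 2 + b1 * x1 * y2 + b3 *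
        y2)).
      by ring.
    by rewrite C1 C2 subrr.
  subst y2; have {}h0 : 2%:R * y1 + b1 * x1 + b3 != 0 by rewrite mulr_natl mulr2n.
  set l' := _ / (2%:R * y1 + _ + _).
  set l := (_ + a4 - _) / _; have -> : l = u * l' + s.
    have D : 2%:R * (u ^+ 3 * y1 + u ^+ 2 * s * x1 + t) + a1 * (u ^+ 2 * x1 + r) + a3
       = u ^+ 3 * (2%:R * y1 + b1 * x1 + b3) by rewrite F3 F1; ring.
    rewrite /l D; apply: (mulIf (_ : u ^+ 3 * (2%:R * y1 + b1 * x1 + b3) != 0)).
      by rewrite mulf_neq0 ?expf_neq0.
    rewrite divfK ?mulf_neq0 ?expf_neq0 //.
    have -> : (u * l' + s) * (u ^+ 3 * (2%:R * y1 + b1 * x1 + b3)) =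
       u ^+ 4 * (l' * (2%:R * y1 + b1 * x1 + b3))
       + s * u ^+ 3 * (2%:R * y1 + b1 * x1 + b3) by ring.
    rewrite [l' * _]divfK //.
    by rewrite F4 F2 F3 F1; ring.
  by congr (Some (_, _)); rewrite F2 ?F3 F1; ring.
have d0 : x2 - x1 != 0 by rewrite subr_eq0 eq_sym.
set l' := (y2 - y1) / (x2 - x1).
set l := _ / (u ^+ 2 * x2 + r - _); have -> : l = u * l' + s.
  have D : u ^+ 2 * x2 + r - (u ^+ 2 * x1 + r) = u ^+ 2 * (x2 - x1) by ring.
  by rewrite /l /l' D; field; rewrite ?d0 ?u0.
by congr (Some (_, _)); rewrite F2 ?F3 F1; ring.
Qed.
End ChangeOfVariables.

Section OrderEleven.
Variable F : fieldType.
Implicit Types W : weierstrass F.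

(** The multiples of [P] are given as a whole sequence [g], additive for [padd] and of exact period
    11. *)
Definition order11 W (P : F * F) : Prop := exists g : nat -> option (F * F),
  [/\ forall k, oncurve W (g k), forall i j, padd W (g i) (g j) = g (i + j)%N,
      g 0 = None, g 1 = Some P & forall i j, g i = g j <-> i = j %[mod 11]].

Lemma order11_of_subgroup (E : ellcurve F) : has_subgroup_isog 'Z_11 E ->
  exists P, order11 E P.
Proof.
move=> [f fi fM]; pose g k := val (f k%:R).
have gM i j : padd E (g i) (g j) = g (i + j)%N by rewrite /g natrD fM.
have gi i j : g i = g j <-> i = j %[mod 11].
  split=> [/val_inj/fi/(congr1 val)|Eij]; first by rewrite /= !val_Zp_nat.
  by congr (val (f _)); apply: val_inj; rewrite /= !val_Zp_nat.
have gC k : oncurve E (g k) by exact: (valP (f k%:R)).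
(* [g 0] is its own double; for an affine point this forces 2 y + a1 x + a3 = 0, which the tangent
   case excludes. *)
have g0 : g 0 = None.
  case E0 : (g 0) => [[x y]|] //; have := gM 0 0; rewrite addn0 E0; clear.
  case: E => -[a1 a2 a3 a4 a6] /= _; rewrite eqxx /=; case: eqP => // h.
  set l := _ / _; case=> Ex Ey; case: h.
  by rewrite -{2}Ey Ex; ring.
case E1 : (g 1) => [P|]; last by have := gi 0 1; rewrite g0 E1 => -[/(_ erefl)].
by exists P, g.
Qed.

Lemma order11_chvar W W' u r s t x y : u != 0 ->
  u * wa1 W' = wa1 W + 2%:R * s ->
  u ^+ 2 * wa2 W' = wa2 W - s * wa1 W + 3%:R * r - s ^+ 2 ->
  u ^+ 3 * wa3 W' = wa3 W + r * wa1 W + 2%:R * t ->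
  u ^+ 4 * wa4 W' = wa4 W - s * wa3 W + 2%:R * r * wa2 W
   - (t + r * s) * wa1 W + 3%:R * r ^+ 2 - 2%:R * s * t ->
  u ^+ 6 * wa6 W' = wa6 W + r * wa4 W + r ^+ 2 * wa2 W + r ^+ 3
   - t * wa3 W - t ^+ 2 - r * t * wa1 W ->
  order11 W (u ^+ 2 * x + r, u ^+ 3 * y + u ^+ 2 * s * x + t) -> order11 W' (x, y).
Proof.
move=> u0 H1 H2 H3 H4 H6 [g [gC gM g0 g1 gi]].
have gC' k : oncurve W' (chvar_inv u r s t (g k)).
  by rewrite -(oncurve_chvar u0 H1 H2 H3 H4 H6) chvar_invK.
exists (fun k => chvar_inv u r s t (g k)); split=> //.
- move=> i j; apply: (can_inj (chvarK r s t u0)).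
  by rewrite -(padd_chvar u0 H1 H2 H3 H4) // !chvar_invK.
- by rewrite g0.
- by rewrite g1 -[LHS]/(chvar_inv u r s t (chvar u r s t (Some (x, y)))) chvarK.
move=> i j; rewrite -gi; split=> [|->] //.
exact: (can_inj (chvar_invK r s t u0)).
Qed.

(** Move [P] to the origin and make its tangent horizontal, so that a4 = a6 = 0. Then a3 and a2 are
    nonzero because 2 P and 3 P are not zero, and scaling by u = a3 / a2 makes them equal. *)
Lemma order11_tate W P : order11 W P -> exists b c, b != 0 /\ order11 (tate b c) (0, 0).
Proof.
case: W P => a1 a2 a3 a4 a6 [x y] O.
pose A3 := a3 + x * a1 + 2%:R * y.
have A30 : A3 != 0.
  case: O => g [gC gM g0 g1 gi]; apply/eqP => h.
  have := gM 1 1; rewrite g1 /= eqxx /=; case: eqP => [_ E|[]]; last by rewrite -h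
      /A3; ring.
  by have := gi 0 2; rewrite g0 -E => -[/(_ erefl)].
pose s := (a4 + 2%:R * x * a2 - y * a1 + 3%:R * x ^+ 2) / A3.
have Es : s * A3 = a4 + 2%:R * x * a2 - y * a1 + 3%:R * x ^+ 2 by rewrite divfK.
pose A1 := a1 + 2%:R * s; pose A2 := a2 - s * a1 + 3%:R * x - s ^+ 2.
have O1 : order11 (Weierstrass A1 A2 A3 0 0) (0, 0).
  apply: (order11_chvar (W := Weierstrass a1 a2 a3 a4 a6) (u := 1) (r := x) (s := s)
      (t := y));
    rewrite /= ?oner_eq0 //.
  - by rewrite mul1r.
  - by rewrite expr1n mul1r.
  - by rewrite expr1n mul1r.
  - rewrite mulr0; apply/eqP; rewrite eq_sym -subr_eq0 subr0 -(subrr (s * A3)) {1}Es /A3.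
    by apply/eqP; ring.
  - have [g [/(_ 1) gC _ _ g1 _]] := O; move: gC; rewrite g1 /= => /eqP E.
    rewrite mulr0; apply/eqP; rewrite eq_sym -subr_eq0 subr0.
    apply/eqP; transitivity (x ^+ 3 + a2 * x ^+ 2 + a4 * x + a6 - (y ^+ 2 + a1 * x *
        y + a3 * y)).
      by ring.
    by rewrite E subrr.
  - by rewrite !mulr0 !add0r.
have A20 : A2 != 0.
  apply/eqP => A20; case: (O1) => g [gC gM g0 g1 gi].
  have g2 : g 2 = Some (0, - A3).
    rewrite -(gM 1 1)%N g1 /= eqxx /= !mulr0 !add0r (negPf A30) A20.
    rewrite expr0n /= !(mulr0, mul0r, subr0, add0r, addr0).
    by congr (Some (_, _)); ring.
  have := gM 1 2; rewrite g1 g2 /= eqxx /=; case: eqP => [_ g3|[]]; last by ring.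
  by have := gi 0 3; rewrite g0 -g3 => -[/(_ erefl)].
exists (- (A2 ^+ 3 / A3 ^+ 2)), (1 - A1 * A2 / A3); split.
  by rewrite oppr_eq0 mulf_neq0 ?invr_eq0 ?expf_neq0.
apply: (order11_chvar (W := Weierstrass A1 A2 A3 0 0) (u := A3 / A2) (r := 0) (s :=
    0) (t := 0)); rewrite /=.
- by rewrite mulf_neq0 ?invr_eq0.
- by field; rewrite ?A20 ?A30.
- by field; rewrite ?A20 ?A30.
- by field; rewrite ?A20 ?A30.
- by ring.
- by ring.
by rewrite !(mulr0, addr0).
Qed.

(* The point [2 P + 3 P] and the tangent at [3 P] give [5 P] and [6 P], and
   [x(5 P) = x(6 P)] is the equation of the modular curve. *)
Lemma x1_11_of_tate b c : b != 0 -> order11 (tate b c) (0, 0) ->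
  exists x y : F, [/\ x1_11 x y, x != 0 & x != 1].
Proof.
move=> b0 [g [gC gM g0 g1 gi]].
have gN k : (0 < k < 11)%N -> g k <> None.
  by rewrite -g0 => k11 /gi; rewrite mod0n modn_small; lia.
have g2 : g 2 = Some (b, b * c).
  rewrite -(gM 1 1)%N g1 /= eqxx /= mulr0 !add0r oppr_eq0 (negPf b0).
  by congr (Some (_, _)); rewrite expr0n /= !(mulr0, mul0r, subr0, add0r, addr0,
      oppr0, opprK); ring.
have g3 : g 3 = Some (c, b - c).
  rewrite -(gM 1 2)%N g1 g2 /= eq_sym (negPf b0) /= !subr0 mulrAC mulfV // mul1r.
  by congr (Some (_, _)); ring.
(* Vanishing of c, b - c or b - c - c^2 would make 4 P, 5 P or 6 P the point at infinity. *)
have c0 : c != 0.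
  apply/eqP => c0; apply: (@gN 4) => //; rewrite -(gM 1 3)%N g1 g3 c0 /= eqxx /=.
  by case: eqP => // -[]; ring.
have bc : b - c != 0.
  rewrite subr_eq0; apply/eqP => bc; apply: (@gN 5) => //; rewrite -(gM 2 3)%N g2 g3
      bc /= eqxx /=.
  by case: eqP => // -[]; ring.
have nbc : (b == c) = false by apply/negbTE; rewrite -subr_eq0.
pose l5 := (b - c - b * c) / (c - b).
have g5 : exists y, g 5 = Some (l5 ^+ 2 + (1 - c) * l5 + b - b - c, y).
  by rewrite -(gM 2 3)%N g2 g3 /= nbc /= opprK; eexists.
have d0 : b - c - c ^+ 2 != 0.
  apply/eqP => d0; apply: (@gN 6) => //; rewrite -(gM 3 3)%N g3 /= eqxx /=.
  by case: eqP => // -[]; rewrite -d0; ring.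
pose l6 := (3%:R * c ^+ 2 - 2%:R * b * c - (1 - c) * (b - c)) / (b - c - c ^+ 2).
have g6 : exists y, g 6 = Some (l6 ^+ 2 + (1 - c) * l6 + b - c - c, y).
  rewrite -(gM 3 3)%N g3 /= eqxx /=; case: eqP => [h|_].
    by case/eqP: d0; rewrite -h; ring.
  set l := _ / _; have -> : l = l6 by rewrite /l /l6; congr (_ / _); ring.
  by rewrite opprK; eexists.
have E : l5 ^+ 2 + (1 - c) * l5 + b - b - c = l6 ^+ 2 + (1 - c) * l6 + b - c - c.
  case: g5 g6 => [y5 g5] [y6 g6]; have := gM 5 6; rewrite g5 g6.
  have -> : g 11 = None by rewrite -g0; apply/gi.
  by rewrite /=; case: eqP.
(* The parametrization b = r c, c = s (r - 1) is inverted, with q = r - 1 and t = s - 1. *)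
pose q := (b - c) / c; pose t := c / q - 1.
have q0 : q != 0 by rewrite mulf_neq0 ?invr_eq0.
have Ec : c = (1 + t) * q by rewrite /t addrC subrK divfK.
have Eb : b = (1 + q) * ((1 + t) * q) by rewrite -Ec /q; field.
have s0 : 1 + t != 0 by apply: contraNneq c0 => s0; rewrite Ec s0 mul0r.
have t0 : t != 0.
  by apply: contraNneq d0 => t0; rewrite Eb Ec t0; apply/eqP; ring.
have C : q ^+ 2 = q * t + q * t ^+ 3 + t ^+ 3.
  apply/eqP; rewrite -subr_eq0 -(mulrI_eq0 _ (mulfI s0)).
  have <- : t ^+ 2 * ((l6 ^+ 2 + (1 - c) * l6 + b - c - c) - (l5 ^+ 2 + (1 - c) * l5
      + b - b - c))
     = (1 + t) * (q ^+ 2 - (q * t + q * t ^+ 3 + t ^+ 3)).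
    have cb : c - b != 0 by rewrite -opprB oppr_eq0.
    have El6 : l6 = - (2%:R * (1 + t) - (1 + q) * (1 + t) - 1) / t.
      by rewrite /l6; apply: (mulIf d0); rewrite divfK // Eb Ec; field.
    have El5 : l5 = (1 + q) * (1 + t) - 1.
      by rewrite /l5; apply: (mulIf cb); rewrite divfK // Eb Ec; ring.
    by rewrite El5 El6 Eb Ec; field.
  by rewrite -E subrr mulr0.
exists (q / t), q; split.
- by rewrite /x1_11 -[RHS]mulr1; apply: (mulIf (expf_neq0 3 t0)); field: C.
- by rewrite mulf_neq0 ?invr_eq0.
apply/eqP => x1; have Eq : q = t by rewrite -[LHS](divfK t0) x1 mul1r.
have /eqP : t ^+ 3 * (1 + t) = 0.
  have -> : t ^+ 3 * (1 + t) = t * t + t * t ^+ 3 + t ^+ 3 - t ^+ 2 by ring.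
  by move: C; rewrite Eq => <-; rewrite subrr.
by rewrite mulf_eq0 expf_eq0 (negPf t0) (negPf s0).
Qed.

End OrderEleven.

(** * Finiteness of the fibres of the j-invariant *)

Section Invariants.
Variable F : fieldType.
Implicit Types W : weierstrass F.

Definition wc4 W : F :=
  (wa1 W ^+ 2 + 4%:R * wa2 W) ^+ 2 - 24%:R * (2%:R * wa4 W + wa1 W * wa3 W).

Lemma wisom_c4_disc W W' : wisom W W' -> exists2 u : F, u != 0 &
  u ^+ 4 * wc4 W' = wc4 W /\ u ^+ 12 * wdisc W' = wdisc W.
Proof.
case: W W' => a1 a2 a3 a4 a6 [b1 b2 b3 b4 b6] [u [r [s [t [u0 H1 H2 H3 [H4 H6]]]]]].
exists u => //; split.
  transitivity (wc4 (Weierstrass (u * b1) (u ^+ 2 * b2) (u ^+ 3 * b3) (u ^+ 4 * b4)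
      (u ^+ 6 * b6))).
    by rewrite /wc4 /=; ring.
  by rewrite H1 H2 H3 H4 H6 /wc4 /=; ring.
transitivity (wdisc (Weierstrass (u * b1) (u ^+ 2 * b2) (u ^+ 3 * b3) (u ^+ 4 * b4)
    (u ^+ 6 * b6))).
  by rewrite /wdisc /=; ring.
by rewrite H1 H2 H3 H4 H6 /wdisc /=; ring.
Qed.

End Invariants.

Lemma wc4_map (F G : fieldType) (f : {rmorphism F -> G}) (W : weierstrass F) :
  wc4 (wmap f W) = f (wc4 W).
Proof. by rewrite /wc4 /= !(rmorph_nat, rmorphB, rmorphD, rmorphM, rmorphXn). Qed.

Lemma wdisc_map (F G : fieldType) (f : {rmorphism F -> G}) (W : weierstrass F) :
  wdisc (wmap f W) = f (wdisc W).
Proof.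
by case: W => *; rewrite /wdisc /= !(rmorph_nat, rmorphB, rmorphD, rmorphN, rmorphM,
    rmorphXn).
Qed.

(** Equality of the j-invariants c4^3 / disc, with denominators cleared; it descends to F because
    [iota] is injective. *)
Lemma isom_over_c4_disc (F L : fieldType) (iota : {rmorphism F -> L}) (E E' :
    ellcurve F) :
  isom_over iota E E' -> wc4 E ^+ 3 * wdisc E' = wc4 E' ^+ 3 * wdisc E.
Proof.
move=> /wisom_c4_disc[u u0 []]; rewrite !wc4_map !wdisc_map => H4 H12.
apply: (fmorph_inj iota); rewrite !(rmorphM, rmorphXn) -H4 -H12; ring.
Qed.

Section RegularFunctions.
Variable F : fieldType.

(** The coordinate ring of C, which is free over F[x] with basis 1, y. *)
Definition regular (f : F -> F -> F) : Prop := exists A B : {poly F},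
  forall x y, x1_11 x y -> f x y = A.[x] + B.[x] * y.

Lemma regular_cst c : regular (fun _ _ => c).
Proof. by exists c%:P, 0 => x y _; rewrite horner0 hornerC mul0r addr0. Qed.

Lemma regular_x : regular (fun x _ => x).
Proof. by exists 'X, 0 => x y _; rewrite horner0 hornerX mul0r addr0. Qed.

Lemma regular_y : regular (fun _ y => y).
Proof. by exists 0, 1 => x y _; rewrite horner0 hornerC mul1r add0r. Qed.

Lemma regularD f g : regular f -> regular g -> regular (fun x y => f x y + g x y).
Proof.
move=> [A [B H]] [A' [B' H']]; exists (A + A'), (B + B') => x y C.
by rewrite (H _ _ C) (H' _ _ C) !hornerD; ring.
Qed.

Lemma regularM f g : regular f -> regular g -> regular (fun x y => f x y * g x y).
Proof.
move=> [A [B H]] [A' [B' H']].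
exists (A * A' + B * B' * ('X ^+ 3 - 'X ^+ 2)), (A * B' + A' * B - B * B') => x y C.
rewrite (H _ _ C) (H' _ _ C) !(hornerXn, hornerD, hornerN, hornerM) -C.
ring.
Qed.

Lemma regularN f : regular f -> regular (fun x y => - f x y).
Proof.
move=> [A [B H]]; exists (- A), (- B) => x y C.
by rewrite (H _ _ C) !hornerN; ring.
Qed.

Lemma regularX f n : regular f -> regular (fun x y => f x y ^+ n).
Proof.
move=> rf; elim: n => [|n IH]; first exact: (regular_cst 1).
have [A [B H]] := regularM rf IH; exists A, B => x y C.
by rewrite exprS H.
Qed.

(* The norm to [F(x)] of a regular function: [y] and [- 1 - y] are conjugate. *)
Lemma regular_zeros f : regular f -> f 1 0 != 0 -> f 1 (-1) != 0 ->
  exists2 N : {poly F}, N != 0 & forall x y, x1_11 x y -> f x y = 0 -> root N x.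
Proof.
move=> [A [B H]] f0 f1; exists (A ^+ 2 - A * B - B ^+ 2 * ('X ^+ 3 - 'X ^+ 2)).
  apply/eqP => /(congr1 (horner^~ 1)); apply/eqP.
  rewrite horner0 !(hornerXn, horner_exp, hornerD, hornerN, hornerM) !expr1n subrr
      mulr0 subr0.
  have -> : A.[1] ^+ 2 - A.[1] * B.[1] = f 1 0 * f 1 (-1).
    by rewrite !H /x1_11; ring.
  exact: mulf_neq0.
move=> x y C fxy; rewrite /root !(hornerXn, horner_exp, hornerD, hornerN, hornerM) -C.
have -> : A.[x] ^+ 2 - A.[x] * B.[x] - B.[x] ^+ 2 * (y ^+ 2 + y) =
    (A.[x] + B.[x] * y) * (A.[x] - B.[x] * (1 + y)) by ring.
by rewrite -(H _ _ C) fxy mul0r.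
Qed.

End RegularFunctions.

Ltac in_regular := repeat first [exact: regular_x | exact: regular_y | exact: regular_cst
  | apply: regularX | apply: regularD | apply: regularN | apply: regularM].

Section Fibres.
Variable F : fieldType.

(* [W11 (y / x) x] rescaled by [x], which clears denominators. *)
Definition scaledW11 (x y : F) : weierstrass F :=
  Weierstrass (x - y * (x + y)) (- (x * ((1 + y) * y * (x + y))))
    (- (x ^+ 2 * ((1 + y) * y * (x + y)))) 0 0.

Lemma scaledW11_c4_disc x y : x != 0 ->
  wc4 (scaledW11 x y) = x ^+ 4 * wc4 (W11 (y / x) x) /\
  wdisc (scaledW11 x y) = x ^+ 12 * wdisc (W11 (y / x) x).
Proof.
move=> x0.
have -> : scaledW11 x y = let W := W11 (y / x) x in
   Weierstrass (x * wa1 W) (x ^+ 2 * wa2 W) (x ^+ 3 * wa3 W) 0 0.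
  by rewrite /scaledW11 /= /tate_b /tate_c /tate_r /tate_s /tate_q; congr
      Weierstrass; field.
by split; [rewrite /wc4|rewrite /wdisc]; rewrite /=; ring.
Qed.

(** At the cusps over x = 1 the rescaled curve degenerates to y^2 + x y = x^3, with c4 = 1 and
    discriminant 0. The regular function comparing j-invariants therefore takes the value [wdisc E]
    there and is not identically zero. *)
Lemma isom_W11_finite (E : ellcurve F) : exists2 N : {poly F}, N != 0 &
  forall x y, x1_11 x y -> x != 0 ->
    wc4 (W11 (y / x) x) ^+ 3 * wdisc E = wc4 E ^+ 3 * wdisc (W11 (y / x) x) -> root N x.
Proof.
pose f x y := wc4 (scaledW11 x y) ^+ 3 * wdisc E - wc4 E ^+ 3 * wdisc (scaledW11 x y).
have rf : regular f by rewrite /f /wc4 /wdisc /=; in_regular.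
have f01 y : y * (1 + y) = 0 -> f 1 y = wdisc E.
  move=> y0; have -> : f 1 y = (wc4 (scaledW11 1 y)) ^+ 3 * wdisc E - wc4 E ^+ 3 *
      wdisc (scaledW11 1 y) by [].
  have -> : scaledW11 1 y = Weierstrass 1 0 0 0 0.
    by rewrite /scaledW11 [(1 + y) * y]mulrC y0 !mul0r !mulr0 oppr0 addr0.
  by rewrite {1}/wc4 [wdisc (Weierstrass _ _ _ _ _)]/wdisc /=; ring.
have f0 : f 1 0 != 0 by rewrite f01 ?mul0r ?ec_nonsingular.
have f1 : f 1 (-1) != 0 by rewrite f01 ?subrr ?mulr0 ?ec_nonsingular.
have [N N0 HN] := regular_zeros rf f0 f1; exists N => // x y C x0 H.
apply: (HN x y) => //; have [H4 H12] := scaledW11_c4_disc y x0.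
rewrite /f H4 H12.
transitivity (x ^+ 12 * (wc4 (W11 (y / x) x) ^+ 3 * wdisc E - wc4 E ^+ 3 * wdisc (W11
    (y / x) x))).
  by ring.
by rewrite H subrr mulr0.
Qed.

End Fibres.

(** * Curves from noncuspidal points over a quartic field, and the conclusion *)

Section QuarticField.
Variable K : fieldExtType rat.
Hypothesis dimK : \dim {:K} = 4%N.

(** Modulo 2 the quintic is t^5 + t^4 + t^3 + t + 1, coprime to X^16 - X and X^8 - X; explicit
    Bezout relations would put 1 in the maximal ideal. *)
Lemma quintic_no_root (t : K) :
  t ^+ 5 + t ^+ 4 - 15%:R * t ^+ 3 - 14%:R * t ^+ 2 + 3%:R * t + 1 != 0.
Proof.
apply/eqP => h.
have [V vV] := nf_valring_exists K (isT : prime 2).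
have sV := vr_subring vV.
have Vt : V t.
  apply: contrapT => /notin_nonunit; set w := t^-1 => Mw; apply: (nonunit1 vV).
  have Vw := nonunit_in vV Mw.
  have t0 : t != 0.
    by apply: contra_eqN h => /eqP ->; rewrite !expr0n /= !mulr0 !subr0 !add0r oner_eq0.
  have -> : 1 = w * (15%:R * w + 14%:R * w ^+ 2 - 3%:R * w ^+ 3 - w ^+ 4 - 1).
    have h5 : t ^+ 5 != 0 by rewrite expf_neq0.
    by apply: (mulIf h5); rewrite -[LHS]subr0 -h /w; field.
  by apply: (nonunitMl vV) => //; in_valring sV.
case: (residue_field_16_or_8 dimK vV Vt) => Ht; apply: (nonunit1 vV).
  apply: (nonunit_mod2 vV (g := t + t ^+ 4) (h := - (2%:R * t - 6%:R * t ^+ 2 - 14%:R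
      * t ^+ 3 - 5%:R * t ^+ 4 - 5%:R * t ^+ 5 - 14%:R * t ^+ 6 - 7%:R * t ^+ 7 + t
      ^+ 8 + t ^+ 9 + 2%:R * t ^+ 10 - 5%:R * t ^+ 11 - 13%:R * t ^+ 12 - 14%:R * t
      ^+ 13 - 6%:R * t ^+ 14 + 3%:R * t ^+ 15 - 5%:R * t ^+ 16 - 14%:R * t ^+ 17 -
      7%:R * t ^+ 18 + t ^+ 19 + t ^+ 20)) Ht); [in_valring sV..|].
  rewrite -[RHS]addr0 -(mulr0 (1 + t + t ^+ 3 + t ^+ 4 + t ^+ 9 + t ^+ 10 + t ^+ 11 +
      t ^+ 14 + t ^+ 15)) -h.
  ring.
apply: (nonunit_mod2 vV (g := 1 + t + t ^+ 2 + t ^+ 3 + t ^+ 4) (h := - (t - 7%:R * t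
    ^+ 2 - 6%:R * t ^+ 3 - 5%:R * t ^+ 4 - 13%:R * t ^+ 5 - 14%:R * t ^+ 6 - 6%:R * t
    ^+ 7 + 3%:R * t ^+ 8 - 6%:R * t ^+ 9 - 7%:R * t ^+ 10 + t ^+ 11 + t ^+ 12)) Ht);
    [in_valring sV..|].
rewrite -[RHS]addr0 -(mulr0 (1 + t ^+ 2 + t ^+ 3 + t ^+ 4 + t ^+ 7)) -h.
ring.
Qed.

(** With t = y / x, the value t = 0 forces x (x - 1) = 0 and t = -1 forces (x - 1)^2 = 0. *)
Lemma x1_11_curve (x y : K) : x1_11 x y -> x != 0 -> x != 1 ->
  exists2 E : ellcurve K, ecw E = W11 (y / x) x & has_subgroup_isog 'Z_11 E.
Proof.
move=> C x0 x1; set t := y / x.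
have Ey : y = t * x by rewrite /t divfK.
have R : x ^+ 2 = x + t ^+ 2 * x + t.
  apply: (mulIf x0); have -> : (x + t ^+ 2 * x + t) * x = (t * x) ^+ 2 + t * x + x ^+
      2 by ring.
  by rewrite -Ey C; ring.
have t0 : t != 0.
  apply/eqP => t0; move: R; rewrite t0 expr0n mul0r !addr0 => /eqP.
  rewrite -subr_eq0; have -> : x ^+ 2 - x = x * (x - 1) by ring.
  by rewrite mulf_eq0 subr_eq0 (negPf x0) (negPf x1).
have s0 : 1 + t != 0.
  apply/eqP => s0; have Et : t = - 1 by apply/eqP; rewrite -addr_eq0 addrC s0.
  have /eqP : (x - 1) ^+ 2 = 0.
    by transitivity (x ^+ 2 - (x + t ^+ 2 * x + t)); [rewrite Et; ring|rewrite -R subrr].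
  by rewrite expf_eq0 subr_eq0 (negPf x1).
exists (E11 R t0 s0 (quintic_no_root t)) => //.
exact: E11_subgroup.
Qed.

End QuarticField.

Theorem theorem9 :
  ~ exists (K : fieldExtType rat) (Kbar : closedFieldType)
      (iota : {rmorphism K -> Kbar}) (n : nat),
    [/\ \dim {: K} = 4%N,
        algebraic_closure iota,
        (0 < n)%N
      & number_up_to (isom_over iota)
          (fun E : ellcurve K => has_subgroup_isog 'Z_11 E) n].
Proof.
move=> [K [Kbar [iota [n [dimK _ n0 [e [eP _ ecover]]]]]]].
have [P /order11_tate[b [c [b0 /(x1_11_of_tate b0)[x [y [C x0 x1]]]]]]] :=
  order11_of_subgroup (eP (Ordinal n0)).
have inj := dbl_orbit_injective dimK C x0 x1.
have orb k : let z := iter k (@dbl K) x in [/\ exists w, x1_11 z w, z != 0 & z != 1].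
  elim: k => [|k [[w Cw] z0 z1]] /=; first by split=> //; exists y.
  have [w' Cw'] := x1_11_dbl dimK Cw; have /andP[? ?] := dbl_noncusp dimK z0 z1.
  by split=> //; exists w'.
have [N HN] : exists N : 'I_n -> {poly K}, forall i, N i != 0 /\
    forall x y, x1_11 x y -> x != 0 ->
    wc4 (W11 (y / x) x) ^+ 3 * wdisc (e i) = wc4 (e i) ^+ 3 * wdisc (W11 (y / x) x)
        -> root (N i) x.
  by exists (fun i => s2val (cid2 (isom_W11_finite (e i)))) => i; case: cid2.
(* Every iterate yields a curve isomorphic to some [e i], hence a root of [M]; the first [size M]
   iterates are then more distinct roots than its degree allows. *)
pose M := \prod_i N i.
have M0 : M != 0 by apply/prodf_neq0 => i _; case: (HN i).
have rootM k : root M (iter k (@dbl K) x).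
  have [[w Cw] z0 z1] := orb k.
  have [E EW /ecover[i /isom_over_c4_disc H]] := x1_11_curve dimK Cw z0 z1.
  rewrite EW in H; have [_ /(_ _ _ Cw z0 H) rN] := HN i.
  by rewrite /M (bigD1 i) //= rootM rN.
have : (size (mkseq (fun k => iter k (@dbl K) x) (size M)) < size M)%N.
  apply: max_poly_roots => //; last exact: mkseq_uniq.
  by apply/allP => _ /mapP[k _ ->]; exact: rootM.
by rewrite size_mkseq ltnn.
Qed.
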